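(* Consider the quadratically constrained quadratic program of minimizing $f_0(x)$ over $x\in\mathbb{R}^n$ subject to $f_i(x)\ge 0$, $i=1,\dots,\ell$, where $f_i(x)=x^TA_ix+b_i^Tx+c_i$ with $A_i$ a real symmetric $n\times n$ matrix, $b_i\in\mathbb{R}^n$, $c_i\in\mathbb{R}$, for $i=0,\dots,\ell$. Suppose that exactly $m\le\ell$ constraints are active at an optimal solution, say those with indices $1,\dots,m$, with $m\le n$, and that the KKT system formed from the active constraints has finitely many complex solutions. Then the algebraic degree of this optimal solution is at most $$2^m\binom{n}{m}.$$ This bound is sharp: for generic quadratic polynomials $f_0,f_1,\dots,f_m$ the algebraic degree equals $2^m\binom{n}{m}$.
   Context: The KKT system formed from the active constraints is the polynomial system in $(x,\lambda)\in\mathbb{C}^n\times\mathbb{C}^m$ given by $\nabla f_0(x)+\sum_{i=1}^m\lambda_i\nabla f_i(x)=0$, $f_1(x)=\cdots=f_m(x)=0$. The algebraic degree is the number of distinct complex solutions of this system when it is finite (equivalently, the number of $x$ occurring in its solutions). Genericity: a property holds for generic $f_0,\dots,f_m$ if it holds whenever the tuple of coefficients (entries of $A_i,b_i,c_i$, $0\le i\le m$) lies in some nonempty Zariski open subset of the coefficient space, depending only on $n$ and $m$. *)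

(* Defs.v *)
From HB Require Import structures.
From mathcomp Require Import all_boot all_order all_algebra.
From mathcomp Require Import finmap mpoly complex.
From mathcomp Require Import classical_sets cardinality reals.

Set Implicit Arguments.
Unset Strict Implicit.
Unset Printing Implicit Defensive.

Import GRing.Theory.
Local Open Scope classical_set_scope.
Local Open Scope ring_scope.

(* The coefficients (A, b, c) of x^T A x + b^T x + c, with A symmetric. *)
Record quadratic (R : realType) (n : nat) := Quadratic {
  quad_mx : 'M[R]_n;
  quad_lin : 'cV[R]_n;
  quad_cst : R;
  quad_mx_sym : quad_mx^T = quad_mx
}.

Definition quad_poly (R : realType) (n : nat) (q : quadratic R n) :
    {mpoly R[n]} :=
  \sum_(i < n) \sum_(j < n) quad_mx q i j *: ('X_i * 'X_j)
  + \sum_(i < n) quad_lin q i 0 *: 'X_i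
  + (quad_cst q)%:MP.

Definition mpeval (K : nzRingType) (n : nat) (p : {mpoly K[n]}) (x : 'cV[K]_n) :
    K :=
  p.@[fun i => x i 0].

Definition grad (K : nzRingType) (n : nat) (p : {mpoly K[n]}) (x : 'cV[K]_n) :
    'cV[K]_n :=
  \col_i mpeval p^`M(i) x.

(* In a tuple [f : 'I_l.+1 -> _] the objective f_0 is [f ord0] and the i-th
   constraint (counted from 0) is [f (lift ord0 i)], i.e. f_(i+1). *)

Definition feasible (R : realType) (n l : nat) (f : 'I_l.+1 -> quadratic R n)
    (x : 'cV[R]_n) : Prop :=
  forall i : 'I_l, 0 <= mpeval (quad_poly (f (lift ord0 i))) x.

Definition optimal (R : realType) (n l : nat) (f : 'I_l.+1 -> quadratic R n)
    (x : 'cV[R]_n) : Prop :=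
  feasible f x /\
  forall y, feasible f y ->
    mpeval (quad_poly (f ord0)) x <= mpeval (quad_poly (f ord0)) y.

Definition active (R : realType) (n l : nat) (f : 'I_l.+1 -> quadratic R n)
    (x : 'cV[R]_n) (i : 'I_l) : Prop :=
  mpeval (quad_poly (f (lift ord0 i))) x = 0.

(* The subtuple f_0, ..., f_m of f_0, ..., f_l. *)
Definition first_quads (R : realType) (n m l : nat) (hml : (m <= l)%N)
    (f : 'I_l.+1 -> quadratic R n) : 'I_m.+1 -> quadratic R n :=
  fun i => f (widen_ord (hml : (m.+1 <= l.+1)%N) i).

Definition complex_poly (R : realType) (n : nat) (q : quadratic R n) :
    {mpoly R[i][n]} :=
  map_mpoly (real_complex R) (quad_poly q).

(* Complex solutions (x, lambda) of the KKT system of f_0, ..., f_m. *)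
Definition KKT_solutions (R : realType) (n m : nat)
    (f : 'I_m.+1 -> quadratic R n) : set ('cV[R[i]]_n * 'cV[R[i]]_m) :=
  [set z : 'cV[R[i]]_n * 'cV[R[i]]_m |
           grad (complex_poly (f ord0)) z.1
             + \sum_(i < m)
                 z.2 i 0 *: grad (complex_poly (f (lift ord0 i))) z.1 = 0
           /\ forall i : 'I_m,
                mpeval (complex_poly (f (lift ord0 i))) z.1 = 0].

(* Only meaningful when the set of solutions is finite: [fset_set] sends an
   infinite set to the empty one. *)
Definition algebraic_degree (R : realType) (n m : nat)
    (f : 'I_m.+1 -> quadratic R n) : nat :=
  #|` fset_set (KKT_solutions f)|%fset.

Definition quad_coefs (R : realType) (n : nat) (q : quadratic R n) :
    'rV[R]_(n * n + (n + 1)) :=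
  row_mx (mxvec (quad_mx q)) (row_mx (quad_lin q)^T (quad_cst q)%:M).

Definition tuple_coefs (R : realType) (n k : nat) (f : 'I_k -> quadratic R n) :
    'rV[R]_(k * (n * n + (n + 1))) :=
  mxvec (\matrix_(i < k) quad_coefs (f i)).

(* Zariski topology on the space of coefficients of k-tuples of quadratics: a
   linear subspace (cut out by the symmetry of the matrices) of the affine space
   of all vectors, with the induced topology.  An open set is the complement of
   the common zeros of a family S of polynomials in the coefficients. *)
Definition Zariski_open (R : realType) (n k : nat)
    (U : set ('I_k -> quadratic R n)) : Prop :=
  exists S : set {mpoly R[k * (n * n + (n + 1))]},
    U = [set f | exists2 p, S p & p.@[tuple_coefs f 0] != 0].

(* Main.v *)
Require Import Defs.
From HB Require Import structures.
From mathcomp Require Import all_boot all_order all_algebra.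
From mathcomp Require Import finmap mpoly complex separable zify ring.

Set Implicit Arguments.
Unset Strict Implicit.
Unset Printing Implicit Defensive.

Import GRing.Theory.
Local Open Scope ring_scope.

(** Write z = (x, lambda) and N = n + m. The KKT system consists of n equations
    of bidegree (1, 1) in (x, lambda) and m equations of bidegree (2, 0), and
    2 ^ m * 'C(n, m) is their bihomogeneous Bezout number D. Both halves of the
    theorem rest on one rank estimate, [rank_macaulay_bound]: let F and G be two
    systems of N polynomials in N variables, let a finite set of p monomials
    span K[z] modulo the ideal of F, and let F have r distinct zeros; then the
    Macaulay matrix of G on these monomials has rank at most p - r. To see it,
    adjoin a variable t and consider H = (t, F + t (G - F)), whose zeros are the
    points (z, 0) with F z = 0. The rows of the Macaulay matrix of
    F + t (G - F) - y are relations between the p monomials once y is replaced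
    by the values of F + t (G - F); they are affine in (t, y), and at t = 1,
    y = 0 they are the rows of the matrix of G, so that as many of them are
    independent as the rank of the latter. Combinations of the monomials whose
    coefficients are polynomials of degree less than d in (t, y) reach all jets
    of order d at the r zeros of H, while multiples of the relations contribute
    nothing; comparing dimensions as d tends to infinity yields the estimate
    ([fiber_count]).

    The estimate is applied against one explicit system, [model]: the KKT system
    of sum_j x_j ^ 2 with the constraints sum_j t_j ^ i x_j ^ 2 = tau ^ i. Its
    equations read x_j * lam (t_j) = 0, with lam the polynomial
    1 + sum_i lambda_i T ^ i, and sum_j v (t_j) x_j ^ 2 = v (tau) for all v of
    degree at most m with v (0) = 0. Interpolation produces D distinct zeros
    (choose the m nodes t_j that are roots of lam, then the signs of the
    corresponding x_j; [model_zeros]) and shows that in each large bidegree D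
    monomials span modulo the multiples of the equations ([model_rank]).

    Upper bound ([bezout_upper]). If F has finitely many zeros, the
    Nullstellensatz makes each coordinate algebraic modulo the ideal of F
    ([finite_zeros_bounded]), hence the monomials of some large bidegree span,
    and the estimate with G = model bounds the number of zeros by D. The
    Nullstellensatz is obtained from the uncountability of the reals.

    Generic equality ([generic_degree]). The estimate with F = model shows that
    the corank of the Macaulay matrix of every system is at least D
    ([rank_upper]). Let u be a linear form taking distinct values at the zeros
    of the model. If the powers 1, u, .., u ^ (D - 1) span modulo the multiples
    of the equations in one large bidegree, then they are a basis of the
    quotient ring, each coordinate is a polynomial in u, and the zeros
    correspond to the roots of the polynomial of degree D cancelled by u
    ([univariate]). Cramer's rule gives this polynomial with coefficients that
    are polynomial in those of the system ([eliminant]). So the product of the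
    determinant in Cramer's rule and of the resultant of the eliminant with its
    derivative defines a Zariski open set on which there are exactly D zeros;
    the model belongs to it. *)

(** * Dimension counts *)

(** A complex K ^ A -> K ^ B -> K ^ C of row vectors, injective on the left and
    surjective on the right. Index types are arbitrary finite types because the
    indices met below are pairs of an integer and a monomial. *)
Lemma card_free_full (K : fieldType) (A B C : finType)
    (theta : A -> B -> K) (psi : B -> C -> K) :
  (forall a c, \sum_b theta a b * psi b c = 0) ->
  (forall x : A -> K, (forall b, \sum_a x a * theta a b = 0) ->
     forall a, x a = 0) ->
  (forall c0, exists y : B -> K, forall c, \sum_b y b * psi b c = (c == c0)%:R) ->
  (#|A| + #|C| <= #|B|)%N.
Proof.
move=> H0 Hfree Hfull.
pose T := \matrix_(i < #|A|, j < #|B|) theta (enum_val i) (enum_val j).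
pose P := \matrix_(i < #|B|, j < #|C|) psi (enum_val i) (enum_val j).
have sumE (X : finType) (F : X -> K) : \sum_(i < #|X|) F (enum_val i) = \sum_x F x.
  by rewrite [RHS](reindex (@enum_val X predT)) //=; apply/onW_bij/enum_val_bij.
have TP0 : T *m P = 0.
  apply/matrixP => i j; rewrite !mxE; under eq_bigr do rewrite !mxE.
  have /= -> := sumE B (fun b => theta (enum_val i) b * psi b (enum_val j)).
  exact: H0.
have Tfree : row_free T.
  apply: inj_row_free => v vT0; apply/rowP => i; rewrite mxE.
  have := Hfree (fun a => v 0 (enum_rank a)) _ (enum_val i).
  rewrite enum_valK; apply=> b.
  move/rowP/(_ (enum_rank b)): vT0; rewrite !mxE; apply: etrans.
  have /= <- := sumE A (fun a => v 0 (enum_rank a) * theta a b).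
  apply: eq_bigr => k _.
  by rewrite !mxE enum_valK enum_rankK.
have Pfull : row_full P.
  rewrite -sub1mx; apply/row_subP => i.
  have [y yP] := Hfull (enum_val i).
  apply/submxP; exists (\row_j y (enum_val j)).
  apply/rowP => j; rewrite !mxE; under eq_bigr do rewrite !mxE.
  have /= -> := sumE B (fun b => y b * psi b (enum_val j)); rewrite yP.
  by rewrite (inj_eq enum_val_inj) eq_sym.
have := mulmx0_rank_max TP0.
by rewrite (eqP Tfree) (eqP Pfull).
Qed.

Lemma card_bmultinom (n d : nat) : #|{: 'X_{1..n < d.+1}}| = 'C(n + d, n).
Proof.
rewrite -card_partial_ord_partitions.
pose f (m : 'X_{1..n < d.+1}) : n.-tuple 'I_d.+1 := [tuple inord (m i) | i < n].
have mi_le (m : 'X_{1..n < d.+1}) i : (m i < d.+1)%N.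
  by apply: leq_ltn_trans (bmdeg m); rewrite mdegE (bigD1 i) //= leq_addr.
have f_inj : injective f.
  move=> m1 m2 e; apply/val_inj/mnmP => i.
  have := congr1 (fun t => val (tnth t i)) e.
  by rewrite !tnth_mktuple /= !inordK.
rewrite -(card_imset _ f_inj); apply: eq_card => t; rewrite inE.
apply/imsetP/idP => [[m _ ->]|tle].
  rewrite big_tuple; under eq_bigr do rewrite tnth_mktuple inordK //.
  by rewrite -mdegE -ltnS; apply: bmdeg.
have mt : (mdeg [multinom val (tnth t i) | i < n] < d.+1)%N.
  rewrite mdegE ltnS; move: tle; rewrite big_tuple.
  by under [X in _ -> (X <= _)%N]eq_bigr do rewrite mnmE.
exists (BMultinom mt) => //; apply: eq_from_tnth => i.
by rewrite tnth_mktuple /= mnmE inord_val.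
Qed.

(** The binomials are the dimensions of the spaces of polynomials of degree at
    most j and j + 1 in r variables. Their ratio (r + j + 1) / (j + 1) tends to
    1, so the inequality survives without them. *)
Lemma binomial_growth (r p q L : nat) :
  (forall j, L * 'C(r + j, r) + q * 'C(r + j.+1, r) <= p * 'C(r + j.+1, r))%N ->
  (L + q <= p)%N.
Proof.
move=> H; rewrite leqNgt; apply/negP => ltp.
(* If L + q > p, the ratio forces r + j + 1 <= L * r, which fails for this j. *)
pose j := (L * r)%N.
have := H j.
have e : ('C(r + j.+1, r) * j.+1 = (r + j.+1) * 'C(r + j, r))%N.
  have := mul_bin_down (r + j).+1 r.
  rewrite -addnS /= (_ : r + j.+1 - r = j.+1)%N; last by lia.
  by rewrite addnS /= -addnS => ->; rewrite mulnC.
have pos : (0 < 'C(r + j, r))%N by rewrite bin_gt0; lia.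
have pos' : (0 < 'C(r + j.+1, r))%N by rewrite bin_gt0; lia.
move: e pos pos'; set x := 'C(_, _); set y := 'C(_, _) => e y0 x0 le1.
have [d ed] : exists d, (L + q = p + d.+1)%N by exists (L + q - p - 1)%N; lia.
have le2 : (L * y + (d.+1) * x <= L * x)%N by nia.
have le3 : (L * y * j.+1 + (d.+1) * x * j.+1 <= L * x * j.+1)%N by nia.
have le4 : (L * y * j.+1 + (d.+1) * ((r + j.+1) * y) <= L * ((r + j.+1) * y))%N by nia.
have le5 : ((d.+1) * ((r + j.+1) * y) <= L * r * y)%N by nia.
have le6 : ((d.+1) * (r + j.+1)  <= L * r)%N by rewrite -(leq_pmul2r y0); nia.
by move: le6; rewrite /j; nia.
Qed.

(** * Jets at finitely many points *)

Section Jets.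
Variables (K : fieldType) (r : nat).
Implicit Types (p q : {mpoly K[r]}) (a : 'I_r -> K).

(** Membership in the j-th power of the maximal ideal of the origin. *)
Definition order_ge (j : nat) p := forall m, (mdeg m < j)%N -> p@_m = 0.

Lemma order_geM i j p q :
  order_ge i p -> order_ge j q -> order_ge (i + j) (p * q).
Proof.
move=> hp hq m lt_m; apply: memN_msupp_eq0; apply/negP.
move=> /msuppM_le/allpairsP[[m1 m2] /= [m1p m2q m_eq]].
move: lt_m; rewrite m_eq mdegD.
have [lt1|le1] := ltnP (mdeg m1) i.
  by move: m1p; rewrite mcoeff_msupp hp ?eqxx.
have [lt2|le2] := ltnP (mdeg m2) j.
  by move: m2q; rewrite mcoeff_msupp hq ?eqxx.
lia.
Qed.

Lemma order_ge_sum j (I : Type) (s : seq I) (P : pred I) (F : I -> {mpoly K[r]}) :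
  (forall i, P i -> order_ge j (F i)) -> order_ge j (\sum_(i <- s | P i) F i).
Proof. by move=> h m ltm; rewrite raddf_sum big1 //= => i Pi; apply: h. Qed.

Lemma order_ge0 p : order_ge 0 p.
Proof. by move=> m. Qed.

Lemma order_ge_exp j p : order_ge 1 p -> order_ge j (p ^+ j).
Proof.
move=> h; elim: j => [|j IH]; first exact: order_ge0.
by rewrite exprS -add1n; apply: order_geM.
Qed.

Lemma order_ge_prod_at (I : finType) j (F : I -> {mpoly K[r]}) i (P : pred I) :
  P i -> order_ge j (F i) -> order_ge j (\prod_(k | P k) F k).
Proof.
move=> Pi h; rewrite (bigD1 i) //= -[j]addn0.
exact: order_geM h (@order_ge0 _).
Qed.

(** The coefficients of [shift a p] are the Taylor coefficients of p at a. *)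
Definition shift a p : {mpoly K[r]} := p \mPo [tuple 'X_i + (a i)%:MP | i < r].

HB.instance Definition _ a := GRing.RMorphism.copy (shift a)
  (comp_mpoly [tuple 'X_i + (a i)%:MP | i < r]).

Lemma mcoeff0E p : p@_0%MM = p.@[fun => 0].
Proof.
rewrite [in RHS](mpolyE p) raddf_sum [in LHS](mpolyE p) raddf_sum /=.
apply: eq_bigr => m _; rewrite mcoeffZ mevalZ mcoeffX mevalX; congr *%R.
have [->|m0] := eqVneq m 0%MM.
  by rewrite big1 // => i _; rewrite mnm0E expr0.
have [i mi] : exists i, m i != 0%N.
  apply/existsP; rewrite -negb_forall; apply: contra m0 => /forallP h.
  by apply/eqP/mnmP => i; rewrite mnm0E; apply/eqP.
by rewrite (bigD1 i) //= expr0n (negbTE mi) mul0r.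
Qed.

Lemma shift0 a p : (shift a p)@_0%MM = p.@[a].
Proof.
rewrite mcoeff0E comp_mpoly_meval; apply: meval_eq => i.
by rewrite tnth_mktuple mevalD mevalXU mevalC add0r.
Qed.

Lemma shiftC a c : shift a c%:MP = c%:MP.
Proof. by rewrite /shift comp_mpolyC. Qed.

Lemma shiftZ a c p : shift a (c *: p) = c *: shift a p.
Proof. by rewrite -!mul_mpolyC rmorphM /= shiftC. Qed.

Lemma shiftX a i : shift a 'X_i = 'X_i + (a i)%:MP.
Proof. by rewrite /shift comp_mpolyXU -tnth_nth tnth_mktuple. Qed.

Lemma order_ge_shift1 a p : p.@[a] = 0 -> order_ge 1 (shift a p).
Proof. by move=> h m; rewrite ltnS leqn0 mdeg_eq0 => /eqP->; rewrite shift0. Qed.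

(** Hermite interpolation. If Q vanishes to order d at all points but the k-th,
    where its value is c <> 0, then 1 - (1 - Q / c) ^ d is congruent modulo
    order d to 1 at the k-th point and to 0 at the other ones. Its product with
    a monomial centred at the k-th point is the required polynomial. *)
Lemma jets_surjective (N : nat) (pts : 'I_N -> 'I_r -> K) (d : nat) :
  (forall k l, pts k =1 pts l -> k = l) ->
  forall k (b : 'X_{1..r}), exists g, forall l m, (mdeg m < d)%N ->
    (shift (pts l) g)@_m = ((l == k) && (m == b))%:R.
Proof.
move=> inj k b.
have /fin_all_exists[s sP] (l : 'I_N) : exists sl : {mpoly K[r]},
    l != k -> sl.@[pts l] = 0 /\ sl.@[pts k] != 0.
  have [->|nlk] := eqVneq l k; first by exists 0.
  have [i ni] : exists i, pts k i != pts l i.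
    apply/existsP; rewrite -negb_forall; apply: contra nlk => /forallP h.
    by apply/eqP/esym/inj => i; apply/eqP.
  exists ('X_i - (pts l i)%:MP) => _.
  by rewrite !mevalB !mevalXU !mevalC subrr subr_eq0.
pose Q := \prod_(l | l != k) s l ^+ d; pose c := Q.@[pts k].
have c0 : c != 0.
  rewrite /c /Q rmorph_prod /=; apply/prodf_neq0 => l nlk.
  rewrite rmorphXn expf_eq0.
  by rewrite (negbTE (proj2 (sP l nlk))) andbF.
pose e := 1 - (1 - c^-1 *: Q) ^+ d.
have ek : order_ge d (shift (pts k) e - 1).
  rewrite /e rmorphB rmorph1 addrAC subrr add0r rmorphXn => m ltm.
  rewrite mcoeffN order_ge_exp ?oppr0 //.
  by apply: order_ge_shift1; rewrite mevalB meval1 mevalZ mulVf ?subrr.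
have el l : l != k -> order_ge d (shift (pts l) e).
  move=> nlk.
  have -> : e = (c^-1 *: Q) * \sum_(i < d) (1 - c^-1 *: Q) ^+ i.
    by rewrite /e -opprB subrX1 addrAC subrr add0r mulNr opprK.
  rewrite rmorphM -[d in order_ge d]addn0; apply: order_geM (@order_ge0 _).
  rewrite /= shiftZ rmorph_prod => m ltm /=.
  rewrite mcoeffZ.
  rewrite (@order_ge_prod_at _ d _ l) ?mulr0 // rmorphXn.
  by apply: order_ge_exp; apply: order_ge_shift1; apply: (sP l nlk).1.
pose h := 'X_[b] \mPo [tuple 'X_i - (pts k i)%:MP | i < r].
have hk : shift (pts k) h = 'X_[b].
  rewrite /h comp_mpolyX rmorph_prod /= [RHS]mpolyXE_id; apply: eq_bigr => i _.
  by rewrite rmorphXn tnth_mktuple rmorphB /= shiftX shiftC addrK.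
exists (e * h) => l m ltm; rewrite rmorphM /=.
have [->|nlk] := eqVneq l k.
  rewrite hk -[shift _ e](subrK 1) mulrDl mul1r mcoeffD.
  rewrite -[d]addn0 in ltm.
  by rewrite (order_geM ek (@order_ge0 _)) // add0r mcoeffX eq_sym.
by rewrite -[d]addn0 in ltm; rewrite (order_geM (el l nlk) (@order_ge0 _)).
Qed.
End Jets.
Arguments shift : simpl never.

(** * Points of a fibre *)

Section Counting.
Variables (K : fieldType) (r p : nat) (H : r.-tuple {mpoly K[r]}).
Variables (v : 'I_p -> {mpoly K[r]}).

(** Expansion along the powers of the ideal of H: the identity
    g = sum c_i v_i + sum h_k H_k is applied again to the h_k, and so on d
    times. The error is in the d-th power of the ideal, hence vanishes to
    order d at the common zeros of H. *)
Lemma adic_expansion (N : nat) (pts : 'I_N -> 'I_r -> K) :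
  (forall k i, (tnth H i).@[pts k] = 0) ->
  (forall g, exists c : 'I_p -> K, exists h : 'I_r -> {mpoly K[r]},
     g = \sum_i c i *: v i + \sum_i h i * tnth H i) ->
  forall d g, exists q : 'I_p -> {mpoly K[r]},
    (forall i, (msize (q i) <= d)%N) /\
    (forall k, order_ge d (shift (pts k) (g - \sum_i (q i \mPo H) * v i))).
Proof.
move=> H0 gen; elim=> [|d IH] g.
  by exists (fun=> 0); split=> // i; rewrite msize0.
have [c [h gE]] := gen g.
have /fin_all_exists[q qP] i := IH (h i).
exists (fun i => (c i)%:MP + \sum_k 'X_k * q k i); split=> [i|k].
  apply: leq_trans (msizeD_le _ _) _; rewrite geq_max; apply/andP; split.
    by rewrite msizeC; case: eqP.
  apply: leq_trans (msize_sum _ _ _) _; apply/bigmax_leqP => k _.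
  rewrite mulrC msizeE; apply/bigmax_leqP_seq => m.
  rewrite (perm_mem (msuppMX _ _)) => /mapP[m' m'q ->] _.
  rewrite mdegD mdeg1 add1n ltnS; apply: leq_trans (msize_mdeg_lt m'q) _.
  exact: (qP k).1.
set D := _ - _.
have -> : D = \sum_i tnth H i * (h i - \sum_j (q i j \mPo H) * v j).
  rewrite /D gE; under [X in _ - X]eq_bigr => i _.
    rewrite rmorphD /= comp_mpolyC mulrDl mul_mpolyC rmorph_sum /= mulr_suml.
    over.
  rewrite big_split /= opprD addrACA subrr add0r exchange_big -sumrB.
  apply: eq_bigr => i _; rewrite mulrBr mulr_sumr mulrC; congr (_ - _).
  by apply: eq_bigr => j _; rewrite rmorphM /= comp_mpolyXU -tnth_nth mulrA.
rewrite rmorph_sum /=; apply: order_ge_sum => i _.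
rewrite rmorphM -add1n; apply: order_geM; last exact: (qP i).2.
exact/order_ge_shift1/H0.
Qed.

(** The number of points of a fibre of H is at most the rank over K[H] of the
    module generated by the v i, here bounded by p - L through L independent
    relations rho. Vectors of p polynomials of degree at most d + 1 map onto the
    jets of order d + 2 at the N points, by [adic_expansion] and
    [jets_surjective]; multiples of the L relations by polynomials of degree at
    most d are mapped to 0. So the three spaces of polynomials and jets satisfy
    the inequality of [card_free_full] for every d, and [binomial_growth]
    concludes. *)
Lemma fiber_count (N L : nat) (pts : 'I_N -> 'I_r -> K)
    (rho : 'I_L -> 'I_p -> {mpoly K[r]}) :
  (forall k l, pts k =1 pts l -> k = l) ->
  (forall k i, (tnth H i).@[pts k] = 0) ->
  (forall g, exists c : 'I_p -> K, exists h : 'I_r -> {mpoly K[r]},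
     g = \sum_i c i *: v i + \sum_i h i * tnth H i) ->
  (forall a i, (msize (rho a i) <= 2)%N) ->
  (forall a, \sum_i (rho a i \mPo H) * v i = 0) ->
  (forall h : 'I_L -> {mpoly K[r]}, (forall i, \sum_a h a * rho a i = 0) ->
     forall a, h a = 0) ->
  (L + N <= p)%N.
Proof.
move=> inj H0 gen rho2 rel free.
apply: (@binomial_growth r p N L) => d.
rewrite -!card_bmultinom.
pose A : finType := ('I_L * 'X_{1..r < d.+1})%type.
pose B : finType := ('I_p * 'X_{1..r < d.+2})%type.
pose C : finType := ('I_N * 'X_{1..r < d.+2})%type.
pose theta (a : A) (b : B) := ('X_[a.2] * rho a.1 b.1)@_b.2.
pose psi (b : B) (c : C) := (shift (pts c.1) (('X_[b.2] \mPo H) * v b.1))@_c.2.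
have sz a i (m : 'X_{1..r < d.+1}) : (msize ('X_[m] * rho a i) <= d.+2)%N.
  rewrite mulrC msizeE; apply/bigmax_leqP_seq => m1.
  rewrite (perm_mem (msuppMX _ _)) => /mapP[m' m'q ->] _.
  rewrite mdegD; have := bmdeg m; have := msize_mdeg_lt m'q.
  by have := rho2 a i; lia.
have psiE (q : 'I_p -> {mpoly K[r]}) (c : C) :
    (forall i, (msize (q i) <= d.+2)%N) ->
    \sum_(b : B) (q b.1)@_b.2 * psi b c
      = (shift (pts c.1) (\sum_i (q i \mPo H) * v i))@_c.2.
  move=> qd; rewrite -(pair_bigA _ (fun (i : 'I_p) (m : 'X_{1..r < d.+2}) => (q i)@_m * psi (i, m) c)) /=.
  rewrite rmorph_sum raddf_sum /=; apply: eq_bigr => i _.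
  rewrite [in RHS](mpolywE (qd i)) rmorph_sum mulr_suml rmorph_sum raddf_sum /=.
  apply: eq_bigr => m _; rewrite /psi /= comp_mpolyZ -scalerAl.
  by rewrite shiftZ mcoeffZ.
have -> : (L * #|{: 'X_{1..r < d.+1}}| = #|A|)%N by rewrite card_prod card_ord.
have -> : (N * #|{: 'X_{1..r < d.+2}}| = #|C|)%N by rewrite card_prod card_ord.
have -> : (p * #|{: 'X_{1..r < d.+2}}| = #|B|)%N by rewrite card_prod card_ord.
apply: (@card_free_full K A B C theta psi).
- move=> [a m] c; rewrite /theta /= (psiE (fun i => 'X_[m] * rho a i)) //.
  rewrite (_ : \sum_i _ = 0) ?raddf0 ?mcoeff0 //.
  under eq_bigr do rewrite rmorphM -mulrA.
  by rewrite -mulr_sumr /= rel mulr0.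
- move=> x x0 [a m].
  pose h a := \sum_(m : 'X_{1..r < d.+1}) x (a, m) *: 'X_[m].
  have := free h _ a; rewrite /h => /(_ _)/(congr1 (mcoeff m)).
  rewrite mcoeff0.
  have -> : (\sum_(m0 : 'X_{1..r < d.+1}) x (a, m0) *: 'X_[m0])@_m = x (a, m).
    rewrite raddf_sum (bigD1 m) //= big1 ?addr0.
      by rewrite mcoeffZ mcoeffX eqxx mulr1.
    by move=> m' nm; rewrite mcoeffZ mcoeffX -bmeqP (negbTE nm) mulr0.
  apply=> i; apply/mpolyP => m1; rewrite mcoeff0.
  have E : \sum_a h a * rho a i
      = \sum_a \sum_(m : 'X_{1..r < d.+1}) x (a, m) *: ('X_[m] * rho a i).
    apply: eq_bigr => a' _; rewrite mulr_suml; apply: eq_bigr => m' _.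
    by rewrite scalerAl.
  rewrite -/(h _) E.
  have [lt|ge] := ltnP (mdeg m1) d.+2.
    apply: etrans (x0 (i, BMultinom lt)); rewrite pair_bigA raddf_sum /=.
    by apply: eq_bigr => -[a' m'] _; rewrite mcoeffZ.
  rewrite raddf_sum big1 // => a' _; rewrite raddf_sum big1 //= => m' _.
  rewrite mcoeffZ memN_msupp_eq0 ?mulr0 //; apply: msize_mdeg_ge.
  exact: leq_trans (sz _ _ _) ge.
- move=> [k b].
  have [g gP] := jets_surjective d.+2 inj k b.
  have [q [qd qP]] := adic_expansion H0 gen d.+2 g.
  exists (fun b : B => (q b.1)@_b.2) => -[l m]; rewrite psiE //=.
  have := qP l m (bmdeg m); rewrite raddfB /= mcoeffB => /subr0_eq <-.
  by rewrite gP ?bmdeg // xpair_eqE bmeqP.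
Qed.
End Counting.

(** * Macaulay matrices and deformation of a system *)

Section Macaulay.
Variables (K : comNzRingType) (N p q : nat).
Variables (X : 'I_p -> 'X_{1..N}) (rk : 'I_q -> 'I_N) (rm : 'I_q -> 'X_{1..N}).
Implicit Types F : 'I_N -> {mpoly K[N]}.

(** All monomials of g are among the X j. *)
Definition supported (g : {mpoly K[N]}) := g = \sum_j g@_(X j) *: 'X_[X j].

(** The classical Macaulay matrix: its rows are the multiples of the equations
    by prescribed monomials, written on the monomials X. *)
Definition macaulay F : 'M[K]_(q, p) :=
  \matrix_(i, j) ('X_[rm i] * F (rk i))@_(X j).

Definition fits F := forall i, supported ('X_[rm i] * F (rk i)).

(** The X j generate the quotient by the ideal of F as a vector space. *)
Definition spans F := forall g, exists c : 'I_p -> K,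
  exists h : 'I_N -> {mpoly K[N]}, g = \sum_j c j *: 'X_[X j] + \sum_k h k * F k.
End Macaulay.

Section Generated.
Variables (K : comNzRingType) (N : nat) (F : 'I_N -> {mpoly K[N]}).

Definition generated (g : {mpoly K[N]}) := exists h : 'I_N -> {mpoly K[N]}, g = \sum_k h k * F k.

Lemma generated0 : generated 0.
Proof. by exists (fun=> 0); rewrite big1 // => *; rewrite mul0r. Qed.

Lemma generatedD f g : generated f -> generated g -> generated (f + g).
Proof.
move=> [h1 ->] [h2 ->]; exists (fun k => h1 k + h2 k).
by rewrite -big_split; apply: eq_bigr => k _; rewrite mulrDl.
Qed.

Lemma generatedM h f : generated f -> generated (h * f).
Proof.
move=> [h1 ->]; exists (fun k => h * h1 k).
by rewrite mulr_sumr; apply: eq_bigr => k _; rewrite mulrA.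
Qed.

Lemma generatedB f g : generated f -> generated g -> generated (f - g).
Proof. by move=> If Ig; rewrite -mulN1r; apply/generatedD/generatedM. Qed.

Lemma generatedZ c f : generated f -> generated (c *: f).
Proof. by move=> If; rewrite -mul_mpolyC; apply: generatedM. Qed.

Lemma generated_mem k : generated (F k).
Proof.
exists (fun j => (j == k)%:R); rewrite (bigD1 k) //= eqxx mul1r big1 ?addr0 //.
by move=> j nj; rewrite (negbTE nj) mul0r.
Qed.

Lemma generated_sum (T : Type) (s : seq T) (Q : pred T) (f : T -> {mpoly K[N]}) :
  (forall i, Q i -> generated (f i)) -> generated (\sum_(i <- s | Q i) f i).
Proof.
by move=> If; elim/big_ind: _ => //; [exact: generated0 | exact: generatedD].
Qed.

Lemma generated_zero z g : (forall k, (F k).@[z] = 0) -> generated g -> g.@[z] = 0.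
Proof.
move=> Fz [h ->]; rewrite raddf_sum big1 // => k _ /=.
by rewrite mevalM Fz mulr0.
Qed.
End Generated.

Section Subst.
Variables (K : comNzRingType) (N : nat).
Implicit Types (u : {mpoly K[N]}) (q : {poly K}).

(** Value of a univariate polynomial at a multivariate one. *)
Definition subst u q : {mpoly K[N]} := (map_poly (@mpolyC N K) q).[u].

HB.instance Definition _ u := GRing.RMorphism.copy (subst u)
  (horner_eval u \o map_poly (@mpolyC N K)).

Lemma substC u c : subst u c%:P = c%:MP.
Proof. by rewrite /subst map_polyC hornerC. Qed.

Lemma substX u : subst u 'X = u.
Proof. by rewrite /subst map_polyX hornerX. Qed.

Lemma substZ u c q : subst u (c *: q) = c *: subst u q.
Proof. by rewrite -mul_polyC rmorphM /= substC mul_mpolyC. Qed.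

Lemma meval_subst u q z : (subst u q).@[z] = q.[u.@[z]].
Proof.
elim/poly_ind: q => [|q c IH]; first by rewrite rmorph0 meval0 horner0.
rewrite rmorphD rmorphM /= substX substC mevalD mevalM mevalC IH.
by rewrite hornerMXaddC.
Qed.
End Subst.

Section RankBound.
Variables (K : fieldType) (N p q : nat).
Variables (X : 'I_p -> 'X_{1..N}) (rk : 'I_q -> 'I_N) (rm : 'I_q -> 'X_{1..N}).
Hypothesis rm_supp : forall i, supported X ('X_[K, rm i]).
Variables (F G : 'I_N -> {mpoly K[N]}).
Hypotheses (Ffit : fits X rk rm F) (Gfit : fits X rk rm G).

Local Notation wid := (widen_ord (leqnSn N)).
Local Notation t := ('X_ord_max : {mpoly K[N.+1]}).

(** The last variable is the parameter t. It is itself an equation, so that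
    the zeros of the pencil are the zeros of F, while t = 1 gives G. *)
Definition pencil (i : 'I_N.+1) : {mpoly K[N.+1]} :=
  if unlift ord_max i is Some k then mwiden (F k) + t * mwiden (G k - F k) else t.

Lemma widE k : wid k = lift ord_max k.
Proof. by apply/val_inj; rewrite /= /bump leqNgt ltn_ord. Qed.

Lemma pencil_wid k : pencil (wid k) = mwiden (F k) + t * mwiden (G k - F k).
Proof. by rewrite /pencil widE liftK. Qed.

Lemma pencil_max : pencil ord_max = t.
Proof. by rewrite /pencil unlift_none. Qed.

Lemma sum_pencil (h : 'I_N.+1 -> {mpoly K[N.+1]}) :
  \sum_i h i * pencil i
    = \sum_k h (wid k) * pencil (wid k) + h ord_max * t.
Proof. by rewrite big_ord_recr /= pencil_max. Qed.

(** Modulo the pencil, t is 0 and F is -t (G - F), hence 0 too. *)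
Lemma pencil_spans : spans X F ->
  forall g, exists c : 'I_p -> K, exists h : 'I_N.+1 -> {mpoly K[N.+1]},
    g = \sum_j c j *: mwiden 'X_[X j] + \sum_i h i * pencil i.
Proof.
move=> sp; elim/mpolyind.
  by exists (fun=> 0), (fun=> 0); rewrite !big1 ?addr0 // => *;
    rewrite ?scale0r ?mul0r.
move=> c m g _ _ [c1 [h1 gE]].
suff [c2 [h2 mE]] : exists c : 'I_p -> K, exists h : 'I_N.+1 -> {mpoly K[N.+1]},
    'X_[m] = \sum_j c j *: mwiden 'X_[X j] + \sum_i h i * pencil i.
  exists (fun j => c * c2 j + c1 j), (fun i => c *: h2 i + h1 i).
  rewrite mE gE scalerDr addrACA !scaler_sumr -!big_split /=; congr (_ + _).
    by apply: eq_bigr => j _; rewrite scalerDl scalerA.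
  by apply: eq_bigr => j _; rewrite mulrDl scalerAl.
have [m0|m0] := eqVneq (m ord_max) 0%N; last first.
  exists (fun=> 0), (fun i => if i == ord_max then 'X_[m - U_(ord_max)] else 0).
  rewrite big1 => [|j _]; last by rewrite scale0r.
  rewrite sum_pencil eqxx big1 => [|k _]; last first.
    by rewrite -val_eqE /= ltn_eqF ?mul0r.
  by rewrite !add0r -mpolyXD submK // lep1mP.
pose m' : 'X_{1..N} := [multinom m (wid i) | i < N].
have -> : m = mnmwiden m'.
  apply/mnmP => i; have [k ->|->] := unliftP ord_max i.
    by rewrite -widE mnmwiden_widen mnmE.
  by rewrite mnmwiden_ordmax.
have [c2 [h2 gm]] := sp 'X_[m'].
rewrite -mwidenX gm.
exists c2, (fun i => if unlift ord_max i is Some k then mwiden (h2 k)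
  else - \sum_k mwiden (h2 k) * mwiden (G k - F k)).
rewrite sum_pencil unlift_none rmorphD !rmorph_sum /=; congr (_ + _).
  by apply: eq_bigr => j _; rewrite mwidenZ.
rewrite mulNr mulr_suml -sumrB; apply: eq_bigr => k _.
rewrite widE liftK -widE pencil_wid mwidenM.
ring.
Qed.

(** Rows of the Macaulay matrix of F + t (G - F) - y. In this ring the last
    variable stands for t and the other ones for the values y_k of the
    equations of the pencil. *)
Definition pencil_row (i : 'I_q) (j : 'I_p) : {mpoly K[N.+1]} :=
  (macaulay X rk rm F i j)%:MP
  + (macaulay X rk rm G i j - macaulay X rk rm F i j) *: t
  - ('X_[rm i])@_(X j) *: 'X_(wid (rk i)).

(** The rows are multiples of the equations F + t (G - F) - y, which vanish once
    y is replaced by F + t (G - F). *)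
Lemma pencil_row_rel i :
  \sum_j (pencil_row i j \mPo [tuple pencil i | i < N.+1]) * mwiden 'X_[X j] = 0.
Proof.
have suppE g : supported X g -> \sum_j g@_(X j) *: mwiden 'X_[X j] = mwiden g.
  move=> sg; rewrite [in RHS]sg rmorph_sum; apply: eq_bigr => j _ /=.
  by rewrite mwidenZ.
have E j : (pencil_row i j \mPo [tuple pencil i | i < N.+1]) * mwiden 'X_[X j]
  = (('X_[rm i] * F (rk i))@_(X j) *: mwiden 'X_[X j])
   + t * (('X_[rm i] * G (rk i))@_(X j) *: mwiden 'X_[X j]
   - ('X_[rm i] * F (rk i))@_(X j) *: mwiden 'X_[X j])
   - pencil (wid (rk i)) * (('X_[rm i])@_(X j) *: mwiden 'X_[X j]).
  rewrite /pencil_row rmorphB rmorphD /= comp_mpolyC !comp_mpolyZ.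
  rewrite !comp_mpolyXU -!tnth_nth !tnth_mktuple pencil_max !mxE.
  by rewrite -!mul_mpolyC mpolyCB; ring.
rewrite (eq_bigr _ (fun j _ => E j)) !sumrB big_split -!mulr_sumr /= sumrB.
rewrite !suppE // pencil_wid !rmorphM rmorphB /=; ring.
Qed.

(** The rank of the system G at t = 1, y = 0 is a lower bound for the number of
    independent rows of the pencil, and [fiber_count] applies to the pencil. *)
Lemma rank_macaulay_bound (n : nat) (pts : 'I_n -> 'I_N -> K) :
  (forall k l, pts k =1 pts l -> k = l) ->
  (forall k i, (F i).@[pts k] = 0) ->
  spans X F ->
  (\rank (macaulay X rk rm G) + n <= p)%N.
Proof.
move=> inj F0 sp; set M := macaulay _ _ _ _.
pose f := maxrankfun M.
pose pts' k (i : 'I_N.+1) : K := if unlift ord_max i is Some k' then pts k k' else 0.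
have mwid_eval k g : (mwiden g).@[pts' k] = g.@[pts k].
  elim/mpolyind: g => [|c m g _ _ IH]; first by rewrite mwiden0 !meval0.
  rewrite mwidenD mwidenZ !mevalD !mevalZ IH mwidenX !mevalX big_ord_recr /=.
  rewrite mnmwiden_ordmax mulr1; congr (_ * _ + _); apply: eq_bigr => i _.
  by rewrite mnmwiden_widen /pts' widE liftK.
apply: (@fiber_count K N.+1 p [tuple pencil i | i < N.+1]
  (fun j => mwiden 'X_[X j]) n _ pts' (fun a => pencil_row (f a))).
- move=> k l e; apply: inj => i; have := e (wid i).
  by rewrite /pts' widE liftK.
- move=> k i; rewrite tnth_mktuple.
  have [k' ->|->] := unliftP ord_max i; last first.
    by rewrite pencil_max mevalXU /pts' unlift_none.
  rewrite -widE pencil_wid mevalD mevalM mevalXU mwid_eval F0.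
  by rewrite /pts' unlift_none mul0r addr0.
- move=> g; have [c [h gE]] := pencil_spans sp g; exists c, h; rewrite {1}gE.
  by congr (_ + _); apply: eq_bigr => i _; rewrite tnth_mktuple.
- move=> a i; rewrite /pencil_row.
  apply: leq_trans (msizeD_le _ _) _; rewrite msizeN geq_max.
  apply/andP; split; last first.
    by apply: leq_trans (msizeZ_le _ _) _; rewrite msizeX mdeg1.
  apply: leq_trans (msizeD_le _ _) _; rewrite geq_max msizeC.
  apply/andP; split; first by case: eqP.
  by apply: leq_trans (msizeZ_le _ _) _; rewrite msizeX mdeg1.
- by move=> a; apply: pencil_row_rel.
move=> h h0.
have /row_freeP[B MB] := maxrowsub_free M; rewrite -/f in MB.
pose P := \matrix_(a, j) pencil_row (f a) j.
pose BB := map_mx (@mpolyC N.+1 K) B.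
pose w (i : 'I_N.+1) : K := (i == ord_max)%:R.
have evP : map_mx (meval w) P = rowsub f M.
  apply/matrixP => a j; rewrite !mxE /pencil_row.
  rewrite mevalB mevalD !mevalZ !mevalXU mevalC /w eqxx.
  rewrite -val_eqE /= ltn_eqF // mulr0 subr0 mulr1 !mxE.
  by rewrite addrC subrK.
(* B is a right inverse of the selected rows of M, so det (P * BB) is 1 at t = 1, y = 0. *)
have dn0 : \det (P *m BB) != 0.
  apply/eqP => d0; have : meval w (\det (P *m BB)) = 1.
    rewrite -det_map_mx map_mxM evP (_ : map_mx (meval w) BB = B) ?MB ?det1 //.
    by apply/matrixP => i j; rewrite !mxE mevalC.
  by rewrite d0 meval0 => /eqP; rewrite eq_sym oner_eq0.
have hP : (\row_a h a) *m P = 0.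
  apply/rowP => j; rewrite !mxE -[RHS](h0 j); apply: eq_bigr => a _.
  by rewrite !mxE.
move=> a; have : (\row_a h a) *m (P *m BB) *m \adj (P *m BB) = 0.
  by rewrite mulmxA hP !mul0mx.
rewrite -mulmxA mul_mx_adj => /rowP/(_ a).
by rewrite mul_mx_scalar !mxE => /eqP; rewrite mulf_eq0 (negbTE dn0) => /eqP.
Qed.
End RankBound.

(** * Bidegrees *)

Section Bidegree.
Variables (n m : nat).
Implicit Types mo : 'X_{1..n + m}.

Definition xdeg mo := (\sum_(i < n) mo (lshift m i))%N.
Definition ldeg mo := (\sum_(i < m) mo (rshift n i))%N.

Lemma mdeg_split mo : mdeg mo = (xdeg mo + ldeg mo)%N.
Proof. by rewrite mdegE big_split_ord. Qed.

Lemma xdegD mo1 mo2 : xdeg (mo1 + mo2)%MM = (xdeg mo1 + xdeg mo2)%N.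
Proof. by rewrite /xdeg -big_split; apply: eq_bigr => i _; rewrite mnmDE. Qed.

Lemma ldegD mo1 mo2 : ldeg (mo1 + mo2)%MM = (ldeg mo1 + ldeg mo2)%N.
Proof. by rewrite /ldeg -big_split; apply: eq_bigr => i _; rewrite mnmDE. Qed.

Lemma xdeg0 : xdeg 0%MM = 0%N.
Proof. by rewrite /xdeg big1 // => i _; rewrite mnm0E. Qed.

Lemma ldeg0 : ldeg 0%MM = 0%N.
Proof. by rewrite /ldeg big1 // => i _; rewrite mnm0E. Qed.

Lemma xdeg_lshift i : xdeg U_(lshift m i)%MM = 1%N.
Proof.
rewrite /xdeg (bigD1 i) //= mnm1E eqxx big1 // => j nj.
by rewrite mnm1E (inj_eq (@lshift_inj _ _)) eq_sym (negbTE nj).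
Qed.

Lemma xdeg_rshift i : xdeg U_(rshift n i)%MM = 0%N.
Proof. by rewrite /xdeg big1 // => j _; rewrite mnm1E eq_rlshift. Qed.

Lemma ldeg_lshift i : ldeg U_(lshift m i)%MM = 0%N.
Proof. by rewrite /ldeg big1 // => j _; rewrite mnm1E eq_lrshift. Qed.

Lemma ldeg_rshift i : ldeg U_(rshift n i)%MM = 1%N.
Proof.
rewrite /ldeg (bigD1 i) //= mnm1E eqxx big1 // => j nj.
by rewrite mnm1E (inj_eq (@rshift_inj _ _)) eq_sym (negbTE nj).
Qed.

Definition bidegE := (xdegD, ldegD, xdeg0, ldeg0, xdeg_lshift, xdeg_rshift, ldeg_lshift, ldeg_rshift).

(** The equations of a KKT system are indexed by n + m: the first n have
    bidegree (1, 1) and the last m have bidegree (2, 0). *)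
Definition eqn_xdeg (k : 'I_(n + m)) := if split k is inl _ then 1%N else 2%N.
Definition eqn_ldeg (k : 'I_(n + m)) := if split k is inl _ then 1%N else 0%N.

Lemma eqn_xdeg_le k : (eqn_xdeg k <= 2)%N.
Proof. by rewrite /eqn_xdeg; case: (split k). Qed.

Lemma eqn_ldeg_le k : (eqn_ldeg k <= 1)%N.
Proof. by rewrite /eqn_ldeg; case: (split k). Qed.

Lemma split_lshift i : split (lshift m i) = inl i :> 'I_n + 'I_m.
Proof. exact: (unsplitK (inl i)). Qed.

Lemma split_rshift i : split (rshift n i) = inr i :> 'I_n + 'I_m.
Proof. exact: (unsplitK (inr i)). Qed.

Section BidegPoly.
Variable K : comNzRingType.
Implicit Types g h : {mpoly K[n + m]}.

Definition bideg a b g := forall mo, mo \in msupp g -> (xdeg mo <= a)%N && (ldeg mo <= b)%N.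

Lemma bideg0 a b : bideg a b 0.
Proof. by move=> mo; rewrite msupp0. Qed.

Lemma bidegD a b g h : bideg a b g -> bideg a b h -> bideg a b (g + h).
Proof. by move=> bg bh mo /msuppD_le; rewrite mem_cat => /orP[/bg|/bh]. Qed.

Lemma bidegZ a b c g : bideg a b g -> bideg a b (c *: g).
Proof. by move=> bg mo /msuppZ_le /bg. Qed.

Lemma bideg_sum a b (I : Type) (s : seq I) (P : pred I) (F : I -> {mpoly K[n + m]}) :
  (forall i, P i -> bideg a b (F i)) -> bideg a b (\sum_(i <- s | P i) F i).
Proof. by move=> bF; elim/big_ind: _ => //; [exact: bideg0 | exact: bidegD]. Qed.

Lemma bidegM a b a' b' g h :
  bideg a b g -> bideg a' b' h -> bideg (a + a') (b + b') (g * h).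
Proof.
move=> bg bh mo /msuppM_le/allpairsP[[m1 m2] /= [/bg/andP[? ?] /bh/andP[? ?] ->]].
by rewrite !bidegE; apply/andP; split; lia.
Qed.

Lemma bidegX mo a b : (xdeg mo <= a)%N -> (ldeg mo <= b)%N -> bideg a b 'X_[mo].
Proof. by move=> ha hb mo'; rewrite msuppX inE => /eqP->; rewrite ha. Qed.

Lemma bidegC a b c : bideg a b c%:MP.
Proof.
by move=> mo; rewrite msuppC; case: eqP => // _; rewrite inE => /eqP->; rewrite !bidegE.
Qed.

Lemma bidegW a b a' b' g : (a <= a')%N -> (b <= b')%N -> bideg a b g -> bideg a' b' g.
Proof. by move=> ha hb bg mo /bg/andP[? ?]; apply/andP; split; lia. Qed.

Lemma bideg_exp a b g k : bideg a b g -> bideg (k * a) (k * b) (g ^+ k).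
Proof.
move=> bg; elim: k => [|k IH]; first by rewrite expr0; apply: bidegC.
by rewrite exprS !mulSn; apply: bidegM.
Qed.

Lemma bideg_pow a b k g : bideg 1 1 g -> (k <= a)%N -> (k <= b)%N ->
  bideg a b (g ^+ k).
Proof.
by move=> bg ha hb; apply: bidegW (bideg_exp (k := k) bg); rewrite muln1.
Qed.

Lemma bideg_x j : bideg 1 0 ('X_(lshift m j) : {mpoly K[n + m]}).
Proof. by apply: bidegX; rewrite !bidegE. Qed.

Lemma bideg_lam i : bideg 0 1 ('X_(rshift n i) : {mpoly K[n + m]}).
Proof. by apply: bidegX; rewrite !bidegE. Qed.

Definition shape (F : 'I_(n + m) -> {mpoly K[n + m]}) := forall k, bideg (eqn_xdeg k) (eqn_ldeg k) (F k).
End BidegPoly.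

Section Columns.
Variables a b : nat.

Definition cols : finType :=
  {mo : bmultinom (n + m) (a + b).+1 | (xdeg mo <= a)%N && (ldeg mo <= b)%N}.
(** The monomials of bidegree at most (a, b), and the multiples of the equations
    which stay in that bidegree; both are numbered through their enumeration. *)
Definition ncols := #|{: cols}|.
Definition col_mon (j : 'I_ncols) : 'X_{1..n + m} := val (val (enum_val j : cols)).

Definition rows : finType :=
  {km : 'I_(n + m) * bmultinom (n + m) (a + b).+1 |
    (xdeg km.2 + eqn_xdeg km.1 <= a)%N && (ldeg km.2 + eqn_ldeg km.1 <= b)%N}.
Definition nrows := #|{: rows}|.
Definition row_eqn (i : 'I_nrows) : 'I_(n + m) := (val (enum_val i : rows)).1.
Definition row_mon (i : 'I_nrows) : 'X_{1..n + m} := val (val (enum_val i : rows)).2.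

Lemma col_mon_inj : injective col_mon.
Proof. by move=> i j /val_inj /val_inj /enum_val_inj. Qed.

Lemma col_monP mo : reflect (exists j, col_mon j = mo) ((xdeg mo <= a)%N && (ldeg mo <= b)%N).
Proof.
apply: (iffP idP) => [h|[j <-]]; last exact: (valP (enum_val j : cols)).
have lt : (mdeg mo < (a + b).+1)%N by rewrite mdeg_split; case/andP: h; lia.
pose c : cols := exist _ (BMultinom lt) h.
by exists (enum_rank c); rewrite /col_mon enum_rankK.
Qed.

Lemma row_ex k mo : (xdeg mo + eqn_xdeg k <= a)%N -> (ldeg mo + eqn_ldeg k <= b)%N ->
  exists i, row_eqn i = k /\ row_mon i = mo.
Proof.
move=> ha hb.
have lt : (mdeg mo < (a + b).+1)%N by rewrite mdeg_split; lia.
have h : (xdeg (k, BMultinom lt).2 + eqn_xdeg (k, BMultinom lt).1 <= a)%N &&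
  (ldeg (k, BMultinom lt).2 + eqn_ldeg (k, BMultinom lt).1 <= b)%N by rewrite ha.
pose c : rows := exist _ (k, BMultinom lt) h.
by exists (enum_rank c); rewrite /row_eqn /row_mon enum_rankK.
Qed.

Lemma row_mon_bound i : (xdeg (row_mon i) + eqn_xdeg (row_eqn i) <= a)%N && (ldeg (row_mon i) + eqn_ldeg (row_eqn i) <= b)%N.
Proof. exact: (valP (enum_val i : rows)). Qed.

Variable K : comNzRingType.

Lemma bideg_supported (g : {mpoly K[n + m]}) : bideg a b g -> supported col_mon g.
Proof.
move=> bg; apply/mpolyP => mo; rewrite raddf_sum /=.
under eq_bigr do rewrite mcoeffZ mcoeffX.
have [h|h] := boolP ((xdeg mo <= a)%N && (ldeg mo <= b)%N).
  have [j jE] := col_monP _ h; rewrite (bigD1 j) //= jE eqxx mulr1 big1 ?addr0 //.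
  by move=> i ni; rewrite -jE (inj_eq col_mon_inj) (negbTE ni) mulr0.
rewrite memN_msupp_eq0; last by apply: contra h => /bg.
rewrite big1 // => j _; case: eqP => [e|]; last by rewrite mulr0.
by case/negP: h; apply/col_monP; exists j.
Qed.

Lemma row_mon_supported i : supported col_mon ('X_[K, row_mon i]).
Proof.
apply: bideg_supported; have /andP[? ?] := row_mon_bound i.
by apply: bidegX; lia.
Qed.

Lemma shape_row (F : 'I_(n + m) -> {mpoly K[n + m]}) i :
  shape F -> bideg a b ('X_[row_mon i] * F (row_eqn i)).
Proof.
move=> sF; have /andP[? ?] := row_mon_bound i.
apply: (bidegW _ _ (bidegM (bidegX (leqnn _) (leqnn _)) (sF _))); lia.
Qed.

Lemma shape_fits (F : 'I_(n + m) -> {mpoly K[n + m]}) : shape F -> fits col_mon row_eqn row_mon F.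
Proof. by move=> sF i; apply/bideg_supported/shape_row. Qed.
End Columns.

Definition macaulay_mx (K : comNzRingType) a b F : 'M[K]_(nrows a b, ncols a b) :=
  macaulay (@col_mon a b) (@row_eqn a b) (@row_mon a b) F.

Definition coef_row (K : comNzRingType) a b (g : {mpoly K[n + m]}) : 'rV[K]_(ncols a b) :=
  \row_j g@_(@col_mon a b j).

Section RowVecRing.
Variables (K : comNzRingType) (a b : nat).
Implicit Types g h : {mpoly K[n + m]}.
Local Notation rv := (coef_row a b).

Lemma coef_row_is_linear : linear (@coef_row K a b).
Proof. by move=> c f g; apply/rowP => j; rewrite !mxE mcoeffD mcoeffZ. Qed.

HB.instance Definition _ := GRing.isLinear.Build K {mpoly K[n + m]}
  'rV[K]_(ncols a b) _ (@coef_row K a b) coef_row_is_linear.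

Lemma coef_row_col_mon j : rv ('X_[K, @col_mon a b j]) = row j 1%:M.
Proof. by apply/rowP => i; rewrite !mxE mcoeffX (inj_eq (@col_mon_inj a b)). Qed.

Lemma coef_row_inj g h : bideg a b g -> bideg a b h -> rv g = rv h -> g = h.
Proof.
move=> bg bh /rowP e; rewrite (bideg_supported bg) (bideg_supported bh).
by apply: eq_bigr => j _; have := e j; rewrite !mxE => ->.
Qed.
End RowVecRing.

Section RowVec.
Variables (K : fieldType) (a b : nat).
Implicit Types (F : 'I_(n + m) -> {mpoly K[n + m]}) (g : {mpoly K[n + m]}).
Local Notation rv := (coef_row a b).

Lemma coef_row_macaulay F k mo : (xdeg mo + eqn_xdeg k <= a)%N -> (ldeg mo + eqn_ldeg k <= b)%N ->
  (rv ('X_[mo] * F k) <= macaulay_mx a b F)%MS.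
Proof.
move=> ha hb; have [i [<- <-]] := row_ex ha hb.
rewrite (_ : rv _ = row i (macaulay_mx a b F)) ?row_sub //.
by apply/rowP => j; rewrite !mxE.
Qed.

Lemma coef_row_full (r : nat) (M : 'M[K]_(r, ncols a b)) :
  (forall mo, (xdeg mo <= a)%N -> (ldeg mo <= b)%N -> (rv ('X_[K, mo]) <= M)%MS) ->
  row_full M.
Proof.
move=> h; rewrite -sub1mx; apply/row_subP => j; rewrite -coef_row_col_mon.
have /andP[? ?] : (xdeg (@col_mon a b j) <= a)%N && (ldeg (@col_mon a b j) <= b)%N.
  by apply/col_monP; exists j.
exact: h.
Qed.
End RowVec.
End Bidegree.

(** * A system attaining the bound *)

Section Interpolation.
Variable K : fieldType.

(** Inverse of a Vandermonde matrix: extraction of the coefficient of index i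
    from the values at d distinct points. *)
Lemma coef_interpolation (d : nat) (s : seq K) : uniq s -> size s = d ->
  forall i : 'I_d, exists c : 'I_d -> K,
    forall k : 'I_d, \sum_(l < d) c l * s`_l ^+ k = (k == i)%:R.
Proof.
move=> us ss i.
pose V := Vandermonde d (\row_(l < d) s`_l).
have Vu : V \in unitmx.
  rewrite unitmxE det_Vandermonde unitfE; apply/prodf_neq0 => j _.
  apply/prodf_neq0 => l lt; rewrite !mxE subr_eq0 nth_uniq ?ss //.
  by rewrite neq_ltn lt orbT.
pose x := invmx V *m (delta_mx i 0 : 'cV_d).
exists (fun l => x l 0) => k.
have /colP/(_ k) : V *m x = delta_mx i 0 by rewrite /x mulKVmx.
rewrite !mxE eqxx andbT => <-; apply: eq_bigr => l _.
by rewrite !mxE mulrC.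
Qed.
End Interpolation.

Section Model.
Variables (K : fieldType) (n m : nat).
Variables (t : 'I_n -> K) (tau : K).
Hypotheses (t_inj : injective t) (t0 : forall j, t j != 0).
Hypotheses (tau0 : tau != 0) (taut : forall j, t j != tau) (char2 : 2 != 0 :> K).
Notation P := {mpoly K[n + m]}.
Implicit Types mo : 'X_{1..n + m}.
Local Notation x j := ('X_(lshift m j) : P).
Local Notation lam i := ('X_(rshift n i) : P).

(** Value at s of the polynomial 1 + sum_i lambda_i T ^ i. *)
Definition lam_at (s : K) : P := 1 + \sum_(i < m) s ^+ i.+1 *: lam i.

(** By linearity the constraints of the model say that [quad_at v] vanishes for
    each v of degree at most m without constant term. *)
Definition quad_at (v : {poly K}) : P := \sum_j v.[t j] *: x j ^+ 2 - v.[tau]%:MP.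

(** The KKT system of the objective sum_j x_j ^ 2 and of the constraints
    sum_j t_j ^ i x_j ^ 2 - tau ^ i, for i = 1, .., m. *)
Definition model (k : 'I_(n + m)) : P :=
  match split k with
  | inl j => 2 *: (x j * lam_at (t j))
  | inr i => quad_at ('X ^+ i.+1)
  end.

Lemma model_shape : shape model.
Proof.
move=> k; rewrite /model /eqn_xdeg /eqn_ldeg; case: (split k) => [j|i].
  have hl : bideg 0 1 (lam_at (t j)).
    apply: bidegD; first exact: bidegC.
    by apply: bideg_sum => i _; apply/bidegZ/bideg_lam.
  by apply: bidegZ; apply: (bidegM (@bideg_x n m K j) hl).
apply: bidegD; last by rewrite -mpolyCN; apply: bidegC.
by apply: bideg_sum => j _; apply: bidegZ; apply: (bideg_exp (k := 2) (@bideg_x n m K j)).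
Qed.

Lemma quad_at_sum (v : {poly K}) : (size v <= m.+1)%N -> v.[0] = 0 ->
  quad_at v = \sum_(i < m) v`_i.+1 *: model (rshift n i).
Proof.
move=> sv v0.
have vE s : v.[s] = \sum_(i < m) v`_i.+1 * s ^+ i.+1.
  rewrite (horner_coef_wide _ sv) big_ord_recl /= -horner_coef0 v0 mul0r add0r.
  by [].
have ZC (c d : K) : c *: d%:MP_[n + m] = (c * d)%:MP.
  by rewrite -mul_mpolyC mpolyCM.
under [RHS]eq_bigr => i _.
  rewrite /model split_rshift /quad_at scalerBr ZC hornerXn scaler_sumr.
  over.
rewrite sumrB exchange_big /quad_at /=; congr (_ - _).
  apply: eq_bigr => j _; rewrite vE scaler_suml; apply: eq_bigr => i _.
  by rewrite scalerA hornerXn.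
by rewrite vE rmorph_sum.
Qed.

Definition xsupp (mo : 'X_{1..n + m}) := [set j | mo (lshift m j) != 0%N].

Lemma xsuppP mo j : reflect (U_(lshift m j) <= mo)%MM (j \in xsupp mo).
Proof. by rewrite inE -lep1mP; apply: idP. Qed.

(** A zero of the model is described by the set of the m indices j such that
    x_j <> 0, and by its subset where a sign is reversed. The same type indexes
    the monomials that span modulo the model. *)
Definition sol_index : finType :=
  {q : {set 'I_n} * {set 'I_n} | (#|q.1| == m) && (q.2 \subset q.1)}.

Lemma card_sol_index : #|{: sol_index}| = (2 ^ m * 'C(n, m))%N.
Proof.
rewrite card_sub.
have -> : #|[pred q : {set 'I_n} * {set 'I_n} | (#|q.1| == m) && (q.2 \subset q.1)]|
   = (\sum_(J : {set 'I_n} | #|J| == m) \sum_(S : {set 'I_n} | S \subset J) 1)%N.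
  rewrite -sum1_card pair_big_dep /=; apply: eq_bigl => -[J S].
  by rewrite inE.
rewrite (eq_bigr (fun _ => 2 ^ m)%N) => [|J /eqP cJ].
  rewrite sum_nat_const mulnC; congr (_ * _)%N.
  have := card_draws 'I_n m; rewrite card_ord => <-.
  by apply: eq_card => J; rewrite !inE.
by rewrite sum1_card -cJ -card_powerset; apply: eq_card => S; rewrite !inE.
Qed.

(** The product of x_j ^ (1 + [j in S]) for j in J. *)
Definition basis_mo (q : sol_index) : 'X_{1..n + m} :=
  [multinom if split k is inl j then ((j \in (val q).1) + (j \in (val q).2))%N else 0%N
   | k < n + m].

Lemma ldeg_basis q : ldeg (basis_mo q) = 0%N.
Proof. by rewrite /ldeg big1 // => i _; rewrite mnmE split_rshift. Qed.

Lemma xdeg_basis q : (xdeg (basis_mo q) <= 2 * m)%N.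
Proof.
have /andP[/eqP cJ /subset_leq_card cS] := valP q.
have sumE (A : {set 'I_n}) : (\sum_j (j \in A) = #|A|)%N.
  by rewrite -sum1_card [RHS]big_mkcond; apply: eq_bigr => j _; case: (j \in A).
rewrite /xdeg; under eq_bigr do rewrite mnmE split_lshift.
rewrite big_split /= !sumE mul2n -addnn leq_add // ?cJ //.
exact: leq_trans cS (eq_leq cJ).
Qed.

Section Spanning.
Variables a b : nat.
Hypotheses (b1 : (0 < b)%N) (a2m : (2 * m <= a)%N).

Definition basis_mx : 'M[K]_(#|{: sol_index}|, ncols n m a b) :=
  \matrix_(i < #|{: sol_index}|) coef_row a b 'X_[basis_mo (enum_val i)].

(** Congruence to a combination of the basis monomials modulo multiples of the
    equations that do not leave the bidegree (a, b). *)
Definition spanned (g : P) : bool := (coef_row a b g <= macaulay_mx a b model + basis_mx)%MS.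

Lemma spanned0 : spanned 0.
Proof. by rewrite /spanned linear0 sub0mx. Qed.

Lemma spannedD g h : spanned g -> spanned h -> spanned (g + h).
Proof. by move=> wg wh; rewrite /spanned linearD addmx_sub. Qed.

Lemma spannedZ c g : spanned g -> spanned (c *: g).
Proof. by move=> wg; rewrite /spanned linearZ scalemx_sub. Qed.

Lemma spanned_sum (I : Type) (s : seq I) (Q : pred I) (F : I -> P) :
  (forall i, Q i -> spanned (F i)) -> spanned (\sum_(i <- s | Q i) F i).
Proof. by move=> h; elim/big_ind: _ => //; [exact: spanned0 | exact: spannedD]. Qed.

Lemma spannedZ_inv c g : c != 0 -> spanned (c *: g) -> spanned g.
Proof. by move=> c0 /(spannedZ c^-1); rewrite scalerA mulVf // scale1r. Qed.

Lemma spanned_basis q : spanned 'X_[basis_mo q].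
Proof.
apply: submx_trans (addsmxSr _ _).
have -> : coef_row a b 'X_[basis_mo q] = row (enum_rank q) basis_mx.
  by rewrite rowK enum_rankK.
exact: row_sub.
Qed.

Lemma spanned_model mo k : (xdeg mo + eqn_xdeg k <= a)%N -> (ldeg mo + eqn_ldeg k <= b)%N ->
  spanned ('X_[mo] * model k).
Proof. by move=> ha hb; apply: submx_trans (addsmxSl _ _); apply: coef_row_macaulay. Qed.

Lemma spanned_lam_at mo j : j \in xsupp mo -> (xdeg mo <= a)%N -> (ldeg mo < b)%N ->
  spanned (lam_at (t j) * 'X_[mo]).
Proof.
move=> /xsuppP le ha hb.
have e := submK le.
have := congr1 (@xdeg n m) e; have := congr1 (@ldeg n m) e; rewrite !bidegE => el ex.
have := @spanned_model (mo - U_(lshift m j))%MM (lshift m j) _ _.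
rewrite /eqn_xdeg /eqn_ldeg /model split_lshift => /(_ _ _) H.
have {H} : spanned ('X_[mo - U_(lshift m j)] * (2 *: (x j * lam_at (t j)))).
  by apply: H; lia.
rewrite -scalerAr => /(spannedZ_inv char2).
by rewrite mulrA -mpolyXD e mulrC.
Qed.

Lemma spanned_quad_at mo (v : {poly K}) : (xdeg mo + 2 <= a)%N -> (ldeg mo <= b)%N ->
  (size v <= m.+1)%N -> v.[0] = 0 -> spanned ('X_[mo] * quad_at v).
Proof.
move=> ha hb sv v0; rewrite quad_at_sum // mulr_sumr; apply: spanned_sum => i _.
rewrite -scalerAr; apply/spannedZ/spanned_model; rewrite /eqn_xdeg /eqn_ldeg split_rshift //.
by rewrite addn0.
Qed.

Lemma quad_at_mul mo (v : {poly K}) : 'X_[mo] * quad_at v =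
  \sum_j v.[t j] *: 'X_[mo + U_(lshift m j) *+ 2] - v.[tau] *: 'X_[mo].
Proof.
rewrite /quad_at mulrBr mulr_sumr mulrC mul_mpolyC; congr (_ - _).
  by apply: eq_bigr => j _; rewrite -scalerAr mpolyXD mpolyXn.
Qed.

(** The coefficients of the polynomial 1 + sum_i lambda_i T ^ i, the constant 1
    among them, are combinations of its values at m + 1 nodes. *)
Lemma spanned_interpolation mo (s : seq K) (i : 'I_m.+1) :
  uniq s -> (m < size s)%N -> (xdeg mo <= a)%N -> (ldeg mo < b)%N ->
  (forall z, z \in s -> spanned (lam_at z * 'X_[mo])) ->
  spanned ((if unlift ord0 i is Some i' then lam i' else 1) * 'X_[mo]).
Proof.
move=> us ss ha hb Ws.
have ss' : size (take m.+1 s) = m.+1 by rewrite size_takel.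
have [c cP] := coef_interpolation (take_uniq m.+1 us) ss' i.
have <- : \sum_(l < m.+1) c l *: lam_at (take m.+1 s)`_l
   = (if unlift ord0 i is Some i' then lam i' else 1).
  rewrite /lam_at; under eq_bigr do rewrite scalerDr scaler_sumr.
  rewrite big_split exchange_big /= -scaler_suml.
  have E k : \sum_(l < m.+1) c l * (take m.+1 s)`_l ^+ k.+1 = (k.+1 == i)%:R * (k < m)%N%:R
    \/ (m <= k)%N.
    have [lt|] := ltnP k m; last by right.
    by left; rewrite mulr1; have := cP (Ordinal (lt : k.+1 < m.+1)%N).
  have c0 : \sum_(l < m.+1) c l = (i == ord0)%:R.
    have := cP ord0; under eq_bigr do rewrite expr0 mulr1.
    by rewrite eq_sym.
  rewrite c0; under eq_bigr => k _.
    under eq_bigr do rewrite scalerA.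
    rewrite -scaler_suml.
    have [->|] := E k; last by rewrite leqNgt ltn_ord.
    rewrite ltn_ord mulr1.
    over.
  case: unliftP => [i' ->|->].
    rewrite scale0r add0r (bigD1 i') // lift0 eqxx scale1r big1 /= ?addr0 // => k nk.
    by rewrite eqSS val_eqE (negbTE nk) scale0r.
  by rewrite eqxx scale1r big1 ?addr0 // => k _; rewrite scale0r.
rewrite mulr_suml; apply: spanned_sum => l _; rewrite -scalerAl.
apply/spannedZ/Ws/(mem_take (n0 := m.+1))/mem_nth; by rewrite ss'.
Qed.

Lemma lam_at0 : lam_at 0 = 1.
Proof.
by rewrite /lam_at big1 ?addr0 // => i _; rewrite exprS mul0r scale0r.
Qed.

Lemma xsuppD mo1 mo2 : xsupp (mo1 + mo2)%MM = xsupp mo1 :|: xsupp mo2.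
Proof. by apply/setP => j; rewrite !inE mnmDE addn_eq0 negb_and. Qed.

Lemma xsupp_lam i : xsupp U_(rshift n i)%MM = set0.
Proof. by apply/setP => j; rewrite !inE mnm1E eq_rlshift. Qed.

Lemma xsupp_x2 j : xsupp (U_(lshift m j) *+ 2)%MM = [set j].
Proof.
apply/setP => k; rewrite !inE mulmnE mnm1E (inj_eq (@lshift_inj _ _)) [k == j]eq_sym.
by case: (j == k).
Qed.

Lemma ldeg_pick mo : (0 < ldeg mo)%N -> exists i, (U_(rshift n i) <= mo)%MM.
Proof.
move=> h; have [i hi] : exists i, mo (rshift n i) != 0%N.
  apply/existsP; apply: contraTT h; rewrite negb_exists => /forallP h.
  rewrite -eqn0Ngt /ldeg; apply/eqP; rewrite big1 // => i _.
  by have := h i; rewrite negbK => /eqP.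
by exists i; rewrite lep1mP.
Qed.

(** When more than m of the x_j divide the monomial, every lam (t_j) times it is
    a multiple of x_j lam (t_j), and these nodes are enough to interpolate. The
    interpolation uses a factor of degree 1 in lambda, which is 1 if the
    monomial has room for it and one of its own lambda_i otherwise. *)
Lemma spanned_large mo : (xdeg mo <= a)%N -> (ldeg mo <= b)%N -> (m < #|xsupp mo|)%N ->
  spanned 'X_[mo].
Proof.
move=> ha hb lt.
pose s := map t (enum (xsupp mo)).
have us : uniq s by rewrite map_inj_uniq ?enum_uniq.
have ss : (m < size s)%N by rewrite size_map -cardE.
have [ltb|] := ltnP (ldeg mo) b.
  have := @spanned_interpolation mo s ord0 us ss ha ltb.
  rewrite unlift_none mul1r; apply=> z /mapP[j]; rewrite mem_enum => jmo ->.
  exact: spanned_lam_at.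
move=> leb; have [i ile] := ldeg_pick (leq_trans b1 leb).
have e := submK ile; set mo' := (mo - _)%MM in e.
have := congr1 (@xdeg n m) e; have := congr1 (@ldeg n m) e; rewrite !bidegE => el ex.
have se : xsupp mo' = xsupp mo by rewrite -e xsuppD xsupp_lam setU0.
have := @spanned_interpolation mo' s (lift ord0 i) us ss _ _.
rewrite liftK -mpolyXD addmC e; apply; [lia|lia|].
move=> z /mapP[j]; rewrite mem_enum -se => jmo ->.
by apply: spanned_lam_at => //; lia.
Qed.

(** With exactly m of the x_j the node 0, where lam takes the value 1, is the
    missing one: lambda_i is congruent to a constant. *)
Lemma spanned_lam mo i : (xdeg mo <= a)%N -> (ldeg mo < b)%N -> (#|xsupp mo| = m) ->
  spanned 'X_[mo] -> spanned ('X_[U_(rshift n i) + mo]).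
Proof.
move=> ha hb cm Wmo.
pose s := 0 :: map t (enum (xsupp mo)).
have us : uniq s.
  rewrite /= map_inj_uniq ?enum_uniq // andbT.
  by apply/mapP => -[j _ /eqP]; rewrite eq_sym (negbTE (t0 j)).
have ss : (m < size s)%N by rewrite /= size_map -cardE cm.
have := @spanned_interpolation mo s (lift ord0 i) us ss ha hb.
rewrite liftK -mpolyXD; apply=> z; rewrite inE => /orP[/eqP->|].
  by rewrite lam_at0 mul1r.
by move=> /mapP[j]; rewrite mem_enum => jmo ->; apply: spanned_lam_at.
Qed.

(** Vanishing at 0 and on J: the combination of constraints that it defines has
    no x_k ^ 2 with k in J. *)
Definition node_poly (J : {set 'I_n}) : {poly K} := 'X * \prod_(k in J) ('X - (t k)%:P).

Lemma size_node_poly J : size (node_poly J) = #|J|.+2.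
Proof.
rewrite /node_poly mulrC size_mulX ?size_prod_XsubC; last first.
  exact/monic_neq0/monic_prod_XsubC.
have := size_prod_XsubC (enum J) t; rewrite big_enum /= => ->.
by rewrite -cardE.
Qed.

Lemma node_poly0 J : (node_poly J).[0] = 0.
Proof. by rewrite hornerM hornerX mul0r. Qed.

Lemma node_poly_root (J : {set 'I_n}) k : k \in J -> (node_poly J).[t k] = 0.
Proof.
move=> kJ; rewrite hornerM horner_prod (bigD1 k) //= hornerXsubC subrr.
by rewrite mul0r mulr0.
Qed.

Lemma node_poly_neq0 (J : {set 'I_n}) s : s != 0 -> (forall k, k \in J -> s != t k) ->
  (node_poly J).[s] != 0.
Proof.
move=> s0 sJ; rewrite hornerM hornerX mulf_neq0 // horner_prod.
by apply/prodf_neq0 => k kJ; rewrite hornerXsubC subr_eq0 sJ.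
Qed.

Section Step.
Variable mo : 'X_{1..n + m}.
Hypotheses (ha : (xdeg mo + 2 <= a)%N) (hb : (ldeg mo <= b)%N) (hm : (#|xsupp mo| <= m)%N).
Hypothesis IH : forall mo', (xdeg mo' <= a)%N -> (ldeg mo' <= b)%N ->
  (#|xsupp mo| < #|xsupp mo'|)%N -> spanned 'X_[mo'].

Lemma spanned_outside (c : K) j : j \notin xsupp mo -> spanned (c *: 'X_[mo + U_(lshift m j) *+ 2]).
Proof.
move=> nj; apply/spannedZ/IH; rewrite ?bidegE.
- by [].
- by rewrite !addn0.
- by rewrite xsuppD xsupp_x2 setUC cardsU1 nj.
Qed.

(** [quad_at] of the node polynomial of the support without j expresses x_j ^ 2
    through a constant and the x_k ^ 2 with k outside the support. *)
Lemma spanned_square j : j \in xsupp mo -> spanned 'X_[mo] -> spanned 'X_[mo + U_(lshift m j) *+ 2].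
Proof.
move=> jm Wmo; pose v := node_poly (xsupp mo :\ j).
have sv : (size v <= m.+1)%N.
  by rewrite size_node_poly; move: hm; rewrite (cardsD1 j) jm.
have := spanned_quad_at ha hb sv (node_poly0 _).
rewrite quad_at_mul (bigD1 j) //= -addrA => H.
apply: (@spannedZ_inv v.[t j]).
  by apply: node_poly_neq0 => // k; rewrite !inE => /andP[nk _]; rewrite (inj_eq t_inj) eq_sym.
rewrite -[_ *: _](addrK (\sum_(i < n | i != j) v.[t i] *: 'X_[mo + U_(lshift m i) *+ 2] - v.[tau] *: 'X_[mo])).
apply: spannedD => //; rewrite -scaleN1r; apply/spannedZ/spannedD; last by rewrite -scaleNr; apply: spannedZ.
apply: spanned_sum => k nk; have [km|km] := boolP (k \in xsupp mo); last exact: spanned_outside.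
by rewrite node_poly_root ?scale0r ?spanned0 // in_setD1 nk.
Qed.

(** [quad_at] of the node polynomial of the whole support expresses a nonzero
    constant through the x_k ^ 2 with k outside the support. *)
Lemma spanned_lower : (#|xsupp mo| < m)%N -> spanned 'X_[mo].
Proof.
move=> lt; pose v := node_poly (xsupp mo).
have sv : (size v <= m.+1)%N by rewrite size_node_poly.
have := spanned_quad_at ha hb sv (node_poly0 _); rewrite quad_at_mul => H.
apply: (@spannedZ_inv (- v.[tau])).
  by rewrite oppr_eq0; apply: node_poly_neq0 => // k _; rewrite eq_sym.
rewrite scaleNr -[- _](addKr (\sum_j v.[t j] *: 'X_[mo + U_(lshift m j) *+ 2])).
apply: spannedD => //; rewrite -scaleN1r; apply/spannedZ/spanned_sum => k _.
have [km|km] := boolP (k \in xsupp mo); last exact: spanned_outside.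
by rewrite node_poly_root ?scale0r ?spanned0.
Qed.
End Step.

Lemma square_split mo j : (2 < mo (lshift m j))%N ->
  exists mo', [/\ mo = (mo' + U_(lshift m j) *+ 2)%MM, xsupp mo' = xsupp mo,
    xdeg mo = (xdeg mo' + 2)%N & ldeg mo = ldeg mo'].
Proof.
move=> lt.
have le : (U_(lshift m j) *+ 2 <= mo)%MM.
  apply/mnm_lepP => k; rewrite mulmnE mnm1E; case: eqP => [<-|//].
  by rewrite mul1n ltnW.
exists (mo - U_(lshift m j) *+ 2)%MM.
have e := submK le; split=> //.
- apply/setP => k; rewrite !inE mnmBE mulmnE mnm1E (inj_eq (@lshift_inj _ _)).
  have [<-|_] := eqVneq j k; last by rewrite mul0n subn0.
  by rewrite mul1n -!lt0n subn_gt0 lt (ltn_trans _ lt).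
- by rewrite -{1}e !bidegE.
- by rewrite -{1}e !bidegE !addn0.
Qed.

(** The multipliers are removed first, then pairs of factors x_j while some
    exponent exceeds 2; what remains is a basis monomial. *)
Lemma spanned_middle mo : (forall mo', (xdeg mo' <= a)%N -> (ldeg mo' <= b)%N ->
    (m < #|xsupp mo'|)%N -> spanned 'X_[mo']) ->
  (xdeg mo <= a)%N -> (ldeg mo <= b)%N -> #|xsupp mo| = m -> spanned 'X_[mo].
Proof.
move=> IH; elim: {mo}(mdeg mo).+1 {-2}mo (ltnSn (mdeg mo)) => // s IHs mo lts ha hb cm.
have [l0|] := posnP (ldeg mo); last first.
  move=> l0; have [i ile] := ldeg_pick l0; have e := submK ile.
  set mo' := (mo - _)%MM in e.
  have := congr1 (@xdeg n m) e; have := congr1 (@ldeg n m) e; rewrite !bidegE => el ex.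
  have se : xsupp mo' = xsupp mo by rewrite -e xsuppD xsupp_lam setU0.
  move: lts; rewrite mdeg_split => lts.
  rewrite -e addmC; apply: spanned_lam; rewrite ?se //; try lia.
  by apply: IHs; rewrite ?mdeg_split ?se //; lia.
have [/existsP[j lt]|] := boolP [exists j, (2 < mo (lshift m j))%N].
  have [mo' [e se ex el]] := square_split lt.
  move: lts; rewrite mdeg_split => lts.
  rewrite e; apply: spanned_square; rewrite ?se ?cm //; try lia.
    by rewrite inE -lt0n; lia.
  by apply: IHs; rewrite ?mdeg_split ?se //; lia.
rewrite negb_exists => /forallP small.
have qP : (#|(xsupp mo, [set j | mo (lshift m j) == 2%N]).1| == m) &&
    ((xsupp mo, [set j | mo (lshift m j) == 2%N]).2 \subset
     (xsupp mo, [set j | mo (lshift m j) == 2%N]).1).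
  by rewrite /= cm eqxx; apply/subsetP => j; rewrite !inE => /eqP->.
pose q : sol_index := exist _ (xsupp mo, [set j | mo (lshift m j) == 2%N]) qP.
have -> : mo = basis_mo q; last exact: spanned_basis.
apply/mnmP => k; rewrite mnmE; case: split_ordP => [j ->|i ->] /=.
  have := small j; rewrite !inE.
  by case: (mo _) => [|[|[|c]]].
by move/eqP: l0; rewrite /ldeg sum_nat_eq0 => /forallP/(_ i)/eqP.
Qed.

(** Descending induction on the number of x_j that divide the monomial. When it
    is less than m, the monomial is replaced by ones with more such x_j; this
    raises the degree in x by 2, so that a monomial of degree above a - 2 must
    first lose a square, which is possible because a >= 2 m. *)
Lemma spanned_all mo : (xdeg mo <= a)%N -> (ldeg mo <= b)%N -> spanned 'X_[mo].
Proof.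
have [k] := ubnP (m.+1 - #|xsupp mo|)%N; elim: k mo => // k IHk mo.
rewrite ltnS => lek ha hb.
have IH mo' : (xdeg mo' <= a)%N -> (ldeg mo' <= b)%N ->
    (#|xsupp mo| < m.+1)%N -> (#|xsupp mo| < #|xsupp mo'|)%N -> spanned 'X_[mo'].
  by move=> ha' hb' lt1 lt2; apply: IHk => //; lia.
have [lt|gt|eq] := ltngtP #|xsupp mo| m; last 2 first.
- exact: spanned_large.
- by apply: spanned_middle => // mo' ha' hb' lt; apply: IH; rewrite ?eq.
have IH1 mo' : (xdeg mo' <= a)%N -> (ldeg mo' <= b)%N ->
    (#|xsupp mo| < #|xsupp mo'|)%N -> spanned 'X_[mo'].
  by move=> ? ? ?; apply: IH => //; apply: ltnW.
have [le|gt] := leqP (xdeg mo + 2) a; first exact: spanned_lower.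
have [/existsP[j lt2]|] := boolP [exists j, (2 < mo (lshift m j))%N].
  have [mo' [e se ex el]] := square_split lt2.
  have IH2 mo1 : (xdeg mo1 <= a)%N -> (ldeg mo1 <= b)%N ->
    (#|xsupp mo'| < #|xsupp mo1|)%N -> spanned 'X_[mo1] by rewrite se; apply: IH1.
  rewrite e; apply: spanned_square => //; rewrite ?se; try lia.
    by rewrite inE; lia.
  by apply: spanned_lower => //; rewrite ?se; lia.
rewrite negb_exists => /forallP small.
have : (xdeg mo <= 2 * #|xsupp mo|)%N.
  rewrite /xdeg (bigID (mem (xsupp mo))) /= addnC big1 => [|j]; last first.
    by rewrite inE negbK => /eqP.
  rewrite add0n mulnC -sum_nat_const; apply: leq_sum => j _.
  by rewrite leqNgt.
lia.
Qed.

Lemma model_rank : (ncols n m a b <= \rank (macaulay_mx a b model) + 2 ^ m * 'C(n, m))%N.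
Proof.
have full := coef_row_full spanned_all.
apply: leq_trans (_ : \rank (macaulay_mx a b model + basis_mx)%MS <= _)%N.
  by rewrite (eqP full).
apply: leq_trans (mxrank_adds_leqif _ _).1 _; rewrite leq_add2l.
by rewrite -card_sol_index; apply: rank_leq_row.
Qed.
End Spanning.
End Model.

From mathcomp Require Import boolp classical_sets functions cardinality reals.
From mathcomp Require constructive_ereal lebesgue_measure.

Import Order.TTheory Num.Theory.
Local Open Scope classical_set_scope.
Local Open Scope ring_scope.

(** * The Nullstellensatz over an uncountable field *)

Lemma uncountable_reals (R : realType) : ~ countable [set: R].
Proof.
move=> cR.
have c01 : countable [set x : R | x \in `[0, 1]].
  exact: (sub_countable (subset_card_le (@subsetT _ _)) cR).
have := lebesgue_measure.countable_lebesgue_measure0 c01.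
rewrite lebesgue_measure.lebesgue_measure_itv /= constructive_ereal.lte_fin ltr01.
by case=> /eqP; rewrite subr0 oner_eq0.
Qed.

(** The reals are not a countable union of finite sets. *)
Lemma infinite_fiber (R : realType) (d : R[i] -> nat) :
  exists n, infinite_set [set c | d c = n].
Proof.
apply: contrapT => /forallNP fin; apply: (@uncountable_reals R).
have -> : [set: R] = \bigcup_(n in [set: nat]) [set x : R | d x%:C%C = n].
  by apply/seteqP; split=> // x _; exists (d x%:C%C).
apply: bigcup_countable => // n _; apply: finite_set_countable.
apply: (@finite_preimage _ _ [set c | d c = n] (fun x : R => x%:C%C)).
  by move=> x y _ _ [].
exact: contrapT (fin n).
Qed.

Section Nullstellensatz.
Variables (K : closedFieldType) (N : nat).
Hypothesis unc : forall d : K -> nat, exists n, infinite_set [set c | d c = n].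
Notation P := {mpoly K[N]}.
Implicit Types (I J : set P).

Definition ideal I :=
  [/\ I 0, forall f g, I f -> I g -> I (f + g) & forall h f, I f -> I (h * f)].

Definition proper_ideal I := ideal I /\ ~ I 1.

(** The ideal generated by I and a. *)
Definition adjoin I (a : P) : set P := [set g | exists h, I (g - h * a)].

Lemma idealB I f g : ideal I -> I f -> I g -> I (f - g).
Proof. by case=> _ hD hM If Ig; rewrite -mulN1r; apply/hD/hM. Qed.

Lemma ideal_sum I (T : Type) (s : seq T) (Q : pred T) (F : T -> P) :
  ideal I -> (forall i, Q i -> I (F i)) -> I (\sum_(i <- s | Q i) F i).
Proof. by case=> h0 hD _ IF; elim/big_ind: _. Qed.

Lemma adjoin_ideal I a : ideal I -> ideal (adjoin I a).
Proof.
move=> idI; have [h0 hD hM] := idI; split.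
- by exists 0; rewrite mul0r subr0.
- move=> f g [h1 H1] [h2 H2]; exists (h1 + h2).
  by rewrite mulrDl opprD addrACA; apply: hD.
- move=> h f [h1 H1]; exists (h * h1).
  by rewrite -mulrA -mulrBr; apply: hM.
Qed.

Lemma adjoin_sub I a : ideal I -> I `<=` adjoin I a.
Proof. by move=> idI f If; exists 0; rewrite mul0r subr0. Qed.

Lemma adjoin_mem I a : ideal I -> adjoin I a a.
Proof. by case=> h0 _ _; exists 1; rewrite mul1r subrr. Qed.

Local Notation evX i := (subst ('X_i : P)).

Lemma subst_lin i c : evX i ('X - c%:P) = 'X_i - c%:MP.
Proof. by rewrite rmorphB /= substX substC. Qed.

(** If a product of factors X_i - c is in I, one of the factors is not
    invertible modulo I. *)
Lemma algebraic_adjoin I i q : proper_ideal I -> q != 0 -> I (evX i q) ->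
  exists c, proper_ideal (adjoin I ('X_i - c%:MP)).
Proof.
move=> [idI pI]; have [h0 hD hM] := idI.
elim: {q}(size q) {-2}q (leqnn (size q)) => [|s IH] q.
  by rewrite leqn0 size_poly_eq0 => /eqP-> /eqP.
move=> sq q0 Iq; have [s1|s1] := eqVneq (size q) 1%N.
  have [c c0 qE] := size_poly1P _ (introT eqP s1).
  case: pI; have := hM (c^-1)%:MP _ Iq.
  by rewrite qE substC -mpolyCM mulVf.
have [c /factor_theorem[q' q'E]] := closed_rootP q s1.
have [ex|npr] := pselect (proper_ideal (adjoin I ('X_i - c%:MP))); first by exists c.
have q'0 : q' != 0 by apply: contraNneq q0 => q'0; rewrite q'E q'0 mul0r.
apply: (IH q') => //.
  by move: sq; rewrite q'E size_Mmonic ?monicXsubC // size_XsubC addn2.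
have [h Ih] : adjoin I ('X_i - c%:MP) 1.
  by apply: contrapT => n1; apply: npr; split=> //; apply: adjoin_ideal.
have -> : evX i q' = evX i q' * (1 - h * ('X_i - c%:MP)) + h * evX i q.
  by rewrite q'E rmorphM /= subst_lin; ring.
by apply: hD; apply: hM.
Qed.

(** Otherwise X_i - c has an inverse modulo I for all c outside a finite set. By
    uncountability infinitely many of these inverses have the same size, hence
    are linearly dependent; clearing denominators in a relation gives a nonzero
    polynomial in X_i that belongs to I. *)
Lemma transcendental_adjoin I i : ideal I ->
  (forall q, q != 0 -> ~ I (evX i q)) ->
  infinite_set [set c | proper_ideal (adjoin I ('X_i - c%:MP))].
Proof.
move=> idI tr fin; have [h0 hD hM] := idI.
pose C := [set c | proper_ideal (adjoin I ('X_i - c%:MP))].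
have /choice[h hP] c : exists h : P, C c \/ I (1 - h * ('X_i - c%:MP)).
  have [Cc|nCc] := pselect (C c); first by exists 0; left.
  have [h Ih] : adjoin I ('X_i - c%:MP) 1.
    by apply: contrapT => n1; apply: nCc; split=> //; apply: adjoin_ideal.
  by exists h; right.
have [n infn] := unc (fun c => msize (h c)).
have := infinite_setD infn fin => /(infinite_set_fset #|{: 'X_{1..N < n}}|.+1).
move=> [B Bsub Bcard].
pose k := #|` B|; pose x (j : 'I_k) := nth 0 (enum_fset B) j.
have xB j : x j \in B by rewrite /x; apply: mem_nth.
have xI j : I (1 - h (x j) * ('X_i - (x j)%:MP)).
  by have [_ nC] := Bsub _ (xB j); have [] := hP (x j).
have xs j : msize (h (x j)) = n by have [] := Bsub _ (xB j).
have x_inj : injective x.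
  move=> j1 j2 /eqP; rewrite /x nth_uniq ?fset_uniq // => /eqP e.
  exact: val_inj.
pose M := \matrix_(j < k, b < #|{: 'X_{1..N < n}}|) (h (x j))@_(enum_val b).
have [a a0 aM] : exists2 a : 'rV_k, a != 0 & a *m M = 0.
  have : kermx M != 0.
    rewrite -mxrank_eq0 mxrank_ker subn_eq0 -ltnNge.
    by apply: leq_ltn_trans (rank_leq_col _) Bcard.
  case/rowV0Pn=> a /sub_kermxP aM a0; by exists a.
have ah : \sum_j a 0 j *: h (x j) = 0.
  apply/mpolyP => m; rewrite mcoeff0 raddf_sum /=.
  have [ltm|gem] := ltnP (mdeg m) n.
    move/rowP/(_ (enum_rank (BMultinom ltm))): aM; rewrite !mxE; apply: etrans.
    by apply: eq_bigr => j _; rewrite !mxE enum_rankK mcoeffZ.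
  rewrite big1 // => j _; rewrite mcoeffZ memN_msupp_eq0 ?mulr0 //.
  by apply: msize_mdeg_ge; rewrite xs.
have [j0 aj0] : exists j, a 0 j != 0.
  apply/existsP; rewrite -negb_forall; apply: contra a0 => /forallP e.
  by apply/eqP/rowP => j; rewrite mxE; apply/eqP.
(* Q is the relation sum_j a_j / (X - x_j) = 0 multiplied by the common denominator. *)
pose q j := \prod_(l | l != j) ('X - (x l)%:P).
pose Q := \sum_j a 0 j *: q j.
apply: (tr Q).
  apply/eqP => /(congr1 (horner^~ (x j0))); rewrite horner0 horner_sum => /eqP.
  rewrite (bigD1 j0) //= big1 ?addr0 => [|j nj]; last first.
    rewrite hornerZ horner_prod (bigD1 j0) 1?eq_sym //=.
    by rewrite hornerXsubC subrr mul0r mulr0.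
  rewrite hornerZ mulf_eq0 (negbTE aj0) horner_prod /=; apply/negP/prodf_neq0.
  by move=> l nl; rewrite hornerXsubC subr_eq0 eq_sym (inj_eq x_inj).
pose spanned := evX i (\prod_l ('X - (x l)%:P)).
have EQ : evX i Q = \sum_j (a 0 j)%:MP * evX i (q j).
  rewrite rmorph_sum; apply: eq_bigr => j _.
  by rewrite -mul_polyC rmorphM /= substC.
have -> : evX i Q = \sum_j (a 0 j)%:MP * evX i (q j) * (1 - h (x j) * ('X_i - (x j)%:MP)).
  rewrite EQ; apply/esym; under eq_bigr => j _.
    rewrite mulrBr mulr1 (_ : _ * (h _ * _) = spanned * (a 0 j *: h (x j))); last first.
      by rewrite /spanned (bigD1 j) //= rmorphM /= subst_lin -/(q j) -mul_mpolyC; ring.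
    over.
  by rewrite sumrB -mulr_sumr ah mulr0 subr0.
by apply: ideal_sum => // j _; apply: hM.
Qed.

Lemma adjoin_step I i : proper_ideal I -> exists c, proper_ideal (adjoin I ('X_i - c%:MP)).
Proof.
move=> pI; have [[q [q0 Iq]]|tr] := pselect (exists q, q != 0 /\ I (evX i q)).
  exact: algebraic_adjoin pI q0 Iq.
apply: infinite_setN0; apply: transcendental_adjoin; first by case: pI.
by move=> q q0 Iq; apply: tr; exists q.
Qed.

(** Weak Nullstellensatz: the coordinates of a zero are chosen one by one. *)
Lemma common_zero I : proper_ideal I -> exists z : 'I_N -> K, forall g, I g -> g.@[z] = 0.
Proof.
move=> pI.
have [J [z [[idJ pJ] IJ Jz]]] : exists J, exists z : 'I_N -> K,
    [/\ proper_ideal J, I `<=` J & forall i, J ('X_i - (z i)%:MP)].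
  have : exists J, exists z : 'I_N -> K,
      [/\ proper_ideal J, I `<=` J & forall i, i \in enum 'I_N -> J ('X_i - (z i)%:MP)].
    elim: (enum _) => [|i s [J [z [pJ IJ Jz]]]].
      by exists I, (fun=> 0); split.
    have [c pc] := adjoin_step i pJ; have [idJ _] := pJ.
    exists (adjoin J ('X_i - c%:MP)), (fun j => if j == i then c else z j).
    split=> // [f If|j]; first by apply: adjoin_sub => //; apply: IJ.
    rewrite inE; case: eqVneq => [-> _|_ /= js]; first exact: adjoin_mem.
    exact/adjoin_sub/Jz.
  by case=> J [z [pJ IJ Jz]]; exists J, z; split=> // i; apply: Jz; rewrite mem_enum.
have [h0 hD hM] := idJ.
have modJ g : J (g - (g.@[z])%:MP).
  elim/mpolyind: g => [|c m g _ _ IH]; first by rewrite meval0 subrr.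
  rewrite mevalD mevalZ mpolyCD opprD addrACA; apply: hD => //.
  rewrite mpolyCM -mul_mpolyC -mulrBr; apply: hM.
  rewrite mevalX mpolyXE_id.
  elim/big_ind2: _ => [|a b c' d Ja Jc|i _]; first by rewrite subrr.
    have -> : b * d - (a * c')%:MP = d * (b - a%:MP) + a%:MP * (d - c'%:MP).
      by rewrite mpolyCM; ring.
    by case: idJ => _ hD hM; apply: hD; apply: hM.
  have [_ hD hM] := idJ.
  rewrite rmorphXn /=; elim: (m i) => [|e IHe]; first by rewrite !expr0 subrr.
  rewrite !exprS; set u := 'X_i ^+ e in IHe *; set w := _ ^+ e in IHe *.
  have -> : 'X_i * u - (z i)%:MP * w
     = u * ('X_i - (z i)%:MP) + (z i)%:MP * (u - w) by ring.
  by apply: hD; apply: hM.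
exists z => g Ig; apply/eqP/negP => /negP gz; apply: pJ.
have : J ((g.@[z])%:MP).
  by rewrite -[_%:MP](subKr g); apply: idealB => //; apply: IJ.
by move/(hM (g.@[z])^-1%:MP); rewrite -mpolyCM mulVf.
Qed.

Lemma generated_ideal (F : 'I_N -> P) : ideal (generated F).
Proof.
by split; [exact: generated0 | exact: generatedD | exact: generatedM].
Qed.

Lemma finite_zeros_algebraic F :
  finite_set [set z : 'rV[K]_N | forall k, (F k).@[z 0] = 0] ->
  forall i, exists2 q, q != 0 & generated F (evX i q).
Proof.
move=> fin i; apply: contrapT => tr.
have tr' q : q != 0 -> ~ generated F (evX i q) by move=> q0 Iq; apply: tr; exists q.
apply: (transcendental_adjoin (generated_ideal F) tr').
pose Z := [set z : 'rV[K]_N | forall k, (F k).@[z 0] = 0].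
apply: (@sub_finite_set _ _ [set z 0 i | z in Z]); last exact: finite_image.
move=> c pc; have [z zP] := common_zero pc.
exists (\row_j z j) => [k|].
  rewrite (meval_eq (v2 := z)) => [|j]; last by rewrite mxE.
  by apply: zP; apply: adjoin_sub; [exact: generated_ideal | exact: generated_mem].
have := zP _ (adjoin_mem _ (generated_ideal F)).
by rewrite mevalB mevalXU mevalC mxE => /subr0_eq.
Qed.

(** Division by a polynomial in each X_i bounds all exponents. *)
Lemma finite_zeros_bounded F :
  finite_set [set z : 'rV[K]_N | forall k, (F k).@[z 0] = 0] ->
  exists d, forall g, exists2 g', generated F (g - g') &
    forall m, m \in msupp g' -> (mdeg m <= d)%N.
Proof.
move=> fin.
have idF := generated_ideal F; have [h0 hD hM] := idF.
have [q qP] : exists q : 'I_N -> {poly K},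
    forall i, q i != 0 /\ generated F (evX i (q i)).
  suff /fin_all_exists : forall i, exists q : {poly K},
    q != 0 /\ generated F (evX i q) by [].
  by move=> i; have [q q0 Iq] := finite_zeros_algebraic fin i; exists q.
have q0 i : q i != 0 := (qP i).1; have Iq i := (qP i).2.
pose d := (\sum_i size (q i))%N.
exists d => g.
pose good g := exists2 g', generated F (g - g') &
    forall m, m \in msupp g' -> (mdeg m <= d)%N.
have goodD f1 f2 : good f1 -> good f2 -> good (f1 + f2).
  move=> [g1 I1 s1] [g2 I2 s2]; exists (g1 + g2).
    by rewrite opprD addrACA; apply: hD.
  by move=> m /msuppD_le; rewrite mem_cat => /orP[/s1|/s2].
have goodZ c f : good f -> good (c *: f).
  move=> [g1 I1 s1]; exists (c *: g1).
    by rewrite -scalerBr -mul_mpolyC; apply: hM.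
  by move=> m /msuppZ_le /s1.
have good0 : good 0 by exists 0; rewrite ?subrr // => m; rewrite msupp0.
have goodI f f1 : generated F (f - f1) -> good f1 -> good f.
  by move=> If [g1 I1 s1]; exists g1 => //; rewrite -(subrK f1 f) -addrA; apply: hD.
suff goodX m : good 'X_[m].
  by elim/mpolyind: g => // c m g _ _ IH; apply: goodD => //; apply: goodZ.
elim: {m}(mdeg m).+1 {-2}m (ltnSn (mdeg m)) => // s IH m lts.
have [[i big]|small] := pselect (exists i, (size (q i) <= m i)%N); last first.
  exists 'X_[m]; first by rewrite subrr.
  move=> m'; rewrite msuppX inE => /eqP->; rewrite mdegE.
  apply: leq_sum => i _; apply/ltnW; rewrite ltnNge; apply/negP => le.
  by apply: small; exists i.
have sq : (0 < size (q i))%N by rewrite lt0n size_poly_eq0 q0.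
pose e := (size (q i)).-1; pose c := lead_coef (q i).
have c0 : c != 0 by rewrite lead_coef_eq0.
have Xm k : (k <= e)%N -> 'X_[m] = 'X_[m - U_(i) *+ e] * 'X_i ^+ e :> P.
  move=> _; rewrite mpolyXn -mpolyXD submK //; apply/mnm_lepP => j.
  rewrite mulmnE mnm1E; case: eqP => [<-|_]; last by rewrite mul0n.
  by rewrite mul1n /e; lia.
have E : evX i (q i) = c *: 'X_i ^+ e + \sum_(k < e) (q i)`_k *: 'X_i ^+ k.
  rewrite /subst horner_coef size_map_poly -(prednK sq) big_ord_recr /= addrC.
  congr (_ + _); first by rewrite coef_map mul_mpolyC -lead_coefE.
  by apply: eq_bigr => k _; rewrite coef_map mul_mpolyC.
pose f1 := \sum_(k < e) (- (c^-1 * (q i)`_k)) *: 'X_[m - U_(i) *+ e + U_(i) *+ k].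
apply: (goodI _ f1).
  have -> : 'X_[m] - f1 = (c^-1 *: 'X_[m - U_(i) *+ e]) * evX i (q i).
    rewrite (Xm 0%N) // E mulrDr -scalerAl -scalerAr scalerA mulVf // scale1r.
    congr (_ + _); rewrite mulr_sumr -sumrN; apply: eq_bigr => k _.
    by rewrite scaleNr opprK mpolyXD -mpolyXn -scalerAl -scalerAr scalerA.
  exact: hM.
rewrite /f1; elim/big_ind: _ => // k _; apply/goodZ/IH.
have le : (U_(i) *+ e <= m)%MM.
  apply/mnm_lepP => j; rewrite mulmnE mnm1E.
  case: eqP => [<-|_]; last by rewrite mul0n.
  by rewrite mul1n /e; lia.
have := congr1 (@mdeg N) (submK le); rewrite !mdegD !mdegMn !mdeg1 => em.
by have := ltn_ord k; lia.
Qed.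

End Nullstellensatz.

(** * Zeros of the model and the bihomogeneous Bezout bound *)

Section MacGenerated.
Variables (K : fieldType) (n m : nat).
Implicit Types (F : 'I_(n + m) -> {mpoly K[n + m]}) (g : {mpoly K[n + m]}).

Lemma macaulay_generated a b F g : shape F -> bideg a b g ->
  (coef_row a b g <= macaulay_mx a b F)%MS -> generated F g.
Proof.
move=> sF bg /submxP[c gc].
have -> : g = \sum_i c 0 i *: ('X_[@row_mon n m a b i] * F (@row_eqn n m a b i)).
  apply: (coef_row_inj bg).
    by apply: bideg_sum => i _; apply/bidegZ/shape_row.
  rewrite gc linear_sum /= mulmx_sum_row; apply: eq_bigr => i _.
  by rewrite linearZ /=; congr (_ *: _); apply/rowP => j; rewrite !mxE.
apply: generated_sum => i _; apply/generatedZ/generatedM/generated_mem.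
Qed.

Lemma generated_macaulay F g : shape F -> generated F g ->
  exists d, forall a b, (d <= a)%N -> (d <= b)%N -> (coef_row a b g <= macaulay_mx a b F)%MS.
Proof.
move=> sF [h ->].
pose d := (\sum_k msize (h k)).+2.
exists d => a b ha hb; rewrite linear_sum; apply: summx_sub => k _ /=.
rewrite {1}[h k]mpolyE mulr_suml linear_sum /= big_seq; apply: summx_sub => mo mh.
rewrite -scalerAl linearZ; apply/scalemx_sub/coef_row_macaulay.
  have := msize_mdeg_lt mh; rewrite mdeg_split.
  have : (msize (h k) <= \sum_k msize (h k))%N by rewrite (bigD1 k) //= leq_addr.
  by have := eqn_xdeg_le k; move: ha; rewrite /d; lia.
have := msize_mdeg_lt mh; rewrite mdeg_split.
have : (msize (h k) <= \sum_k msize (h k))%N by rewrite (bigD1 k) //= leq_addr.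
by have := eqn_ldeg_le k; move: hb; rewrite /d; lia.
Qed.

Lemma bideg_msize g : exists d, forall a b, (d <= a)%N -> (d <= b)%N -> bideg a b g.
Proof.
exists (msize g) => a b ha hb mo /msize_mdeg_lt; rewrite mdeg_split => lt.
have le := ltnW lt; apply/andP; split.
  exact: leq_trans (leq_addr _ _) (leq_trans le ha).
exact: leq_trans (leq_addl _ _) (leq_trans le hb).
Qed.
End MacGenerated.

Section ModelZeros.
Variables (K : closedFieldType) (n m : nat).
Variables (t : 'I_n -> K) (tau : K).
Hypotheses (t_inj : injective t) (t0 : forall j, t j != 0).
Hypotheses (tau0 : tau != 0) (taut : forall j, t j != tau) (char2 : 2 != 0 :> K).
Local Notation model := (@model K n m t tau).

(** [spanned_all] in a bidegree large enough for g. The basis monomials do not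
    depend on the bidegree. *)
Lemma model_spans a b : (0 < b)%N -> (2 * m <= a)%N -> spans (@col_mon n m a b) model.
Proof.
move=> b1 a2m g.
have [d dP] := bideg_msize g.
pose a' := maxn a d; pose b' := maxn b d.
have b1' : (0 < b')%N by rewrite /b'; lia.
have a2m' : (2 * m <= a')%N by rewrite /a'; lia.
have bg : bideg a' b' g by apply: dP; rewrite /a' /b'; lia.
have Wg : spanned t tau a' b' g.
  rewrite [g]mpolyE big_seq; apply: spanned_sum => mo mg.
  by have /andP[? ?] := bg _ mg; apply/spannedZ/spanned_all.
have [[c1 c2] /= gE] := sub_addsmxP Wg.
pose e := \sum_q c2 0 q *: 'X_[basis_mo (enum_val q)] : {mpoly K[n + m]}.
have be : bideg a b e.
  apply: bideg_sum => q _; apply/bidegZ/bidegX; last by rewrite ldeg_basis.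
  exact: leq_trans (xdeg_basis _) a2m.
have be' : bideg a' b' e by apply: bidegW be; rewrite ?leq_maxl.
have [h hE] : generated model (g - e).
  apply: (@macaulay_generated _ _ _ a' b'); first exact: model_shape.
    by apply: bidegD => //; rewrite -scaleN1r; apply: bidegZ.
  rewrite linearB /= gE /e linear_sum /= -addrA.
  rewrite (_ : _ - _ = 0) ?addr0 ?submxMl //; apply/eqP; rewrite subr_eq0.
  apply/eqP; rewrite mulmx_sum_row; apply: eq_bigr => q _.
  by rewrite linearZ /= rowK.
exists (fun j => e@_(col_mon j)), h.
by rewrite -hE -(bideg_supported be) addrC subrK.
Qed.

Lemma sqrt_exists (c : K) : exists y, y ^+ 2 = c.
Proof.
have s1 : size ('X^2 - c%:P : {poly K}) != 1%N by rewrite size_XnsubC.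
have [y] := closed_rootP _ s1.
by rewrite rootE !hornerE subr_eq0 => /eqP; exists y.
Qed.

(** The value of 1 + sum_i lambda_i T ^ i at a zero whose nonzero x_j are those
    with j in J. *)
Definition sol_lam (J : {set 'I_n}) : {poly K} :=
  \prod_(j in J) (1 - (t j)^-1 *: 'X).

Lemma sol_lam0 (J : {set 'I_n}) : (sol_lam J)`_0 = 1.
Proof.
rewrite -horner_coef0 horner_prod big1 // => j _.
by rewrite !hornerE ?mulr0 ?subr0.
Qed.

Lemma size_sol_lam (J : {set 'I_n}) : #|J| = m -> (size (sol_lam J) <= m.+1)%N.
Proof.
move=> cJ; apply: leq_trans (size_poly_prod_leq _ _) _.
rewrite -cJ leq_subLR.
rewrite addnS ltnS -sum1_card -big_split /=.
apply: leq_sum => j _.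
apply: leq_trans (size_polyD _ _) _; rewrite size_poly1 geq_max /= size_polyN.
by apply: leq_trans (size_scale_leq _ _) _; rewrite size_polyX.
Qed.

Lemma sol_lam_root (J : {set 'I_n}) j : j \in J -> (sol_lam J).[t j] = 0.
Proof.
move=> jJ; rewrite horner_prod (bigD1 j) //= !hornerE mulVf ?t0 //.
by rewrite subrr mul0r.
Qed.

Local Notation npoly J j := (node_poly t (J :\ j)).

Lemma npoly_other (J : {set 'I_n}) (j k : 'I_n) :
  k \in J -> k != j -> (npoly J j).[t k] = 0.
Proof. by move=> kJ nk; apply: node_poly_root; rewrite in_setD1 nk. Qed.

Lemma npoly_self (J : {set 'I_n}) (j : 'I_n) : (npoly J j).[t j] != 0.
Proof.
apply: node_poly_neq0 => // k; rewrite in_setD1 => /andP[nk _].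
by rewrite (inj_eq t_inj) eq_sym.
Qed.

Lemma npoly_tau (J : {set 'I_n}) (j : 'I_n) : (npoly J j).[tau] != 0.
Proof. by apply: node_poly_neq0 => // k _; rewrite eq_sym. Qed.

(** Lagrange interpolation at 0 and at the nodes of J: the difference has degree
    at most m and m + 1 roots. *)
Lemma lagrange_tau (J : {set 'I_n}) (v : {poly K}) :
  #|J| = m -> (size v <= m.+1)%N -> v.[0] = 0 ->
  \sum_(j in J) v.[t j] * ((npoly J j).[tau] / (npoly J j).[t j]) = v.[tau].
Proof.
move=> cJ sv v0; pose w := \sum_(j in J) (v.[t j] / (npoly J j).[t j]) *: npoly J j - v.
suff w0 : w = 0.
  have : w.[tau] = 0 by rewrite w0 horner0.
  rewrite hornerD hornerN horner_sum => /subr0_eq <-.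
  by apply: eq_bigr => j _; rewrite hornerZ mulrAC mulrA.
pose rs := 0 :: map t (enum J).
apply/eqP; apply/negP => /negP w0.
have urs : uniq rs.
  rewrite /= map_inj_uniq ?enum_uniq // andbT.
  by apply/mapP => -[j _ /eqP]; rewrite eq_sym (negbTE (t0 j)).
have wr : all (root w) rs.
  apply/allP => z; rewrite inE => /orP[/eqP->|/mapP[k]].
    rewrite rootE hornerD hornerN horner_sum v0 big1 ?subrr // => j _.
    by rewrite hornerZ node_poly0 mulr0.
  rewrite mem_enum => kJ ->; rewrite rootE hornerD hornerN horner_sum.
  rewrite (bigD1 k) //= hornerZ divfK ?npoly_self // big1 ?addr0 ?subrr // => j.
  case/andP=> jJ nj; have nk : k != j by rewrite eq_sym.
  by rewrite hornerZ (npoly_other kJ nk) mulr0.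
have := max_poly_roots w0 wr urs.
rewrite /= size_map -cardE cJ ltnNge => /negP; apply.
apply: leq_trans (size_polyD _ _) _; rewrite size_polyN geq_max sv andbT.
apply: leq_trans (size_sum _ _ _) _; apply/bigmax_leqP => j jJ.
apply: leq_trans (size_scale_leq _ _) _; rewrite size_node_poly.
by rewrite -cJ (cardsD1 j J) jJ.
Qed.

(** The multipliers are the coefficients of [sol_lam], and x_j ^ 2 for j in J is
    the value at tau of the Lagrange polynomial of the node t_j. *)
Lemma model_zeros : exists pts : sol_index n m -> 'I_(n + m) -> K,
  (forall q1 q2, pts q1 =1 pts q2 -> q1 = q2) /\
  (forall q k, (model k).@[pts q] = 0).
Proof.
have sq (J : {set 'I_n}) j : exists y, y ^+ 2 == (npoly J j).[tau] / (npoly J j).[t j].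
  by have [y yE] := sqrt_exists ((npoly J j).[tau] / (npoly J j).[t j]); exists y; apply/eqP.
pose s J j := xchoose (sq J j).
have sE J j : s J j ^+ 2 = (npoly J j).[tau] / (npoly J j).[t j].
  by apply/eqP; exact: (xchooseP (sq J j)).
have s0 J j : s J j != 0.
  apply/eqP => e; have : s J j ^+ 2 != 0.
    by rewrite sE mulf_neq0 ?invr_eq0 ?npoly_self ?npoly_tau.
  by rewrite e expr0n eqxx.
pose xq (q : sol_index n m) (j : 'I_n) : K := if j \in (val q).1 then
  (if j \in (val q).2 then - s (val q).1 j else s (val q).1 j) else 0.
pose pts (q : sol_index n m) (k : 'I_(n + m)) : K := match fintype.split k with
  | inl j => xq q j
  | inr i => (sol_lam (val q).1)`_i.+1 end.
have ptsl q j : pts q (lshift m j) = xq q j by rewrite /pts split_lshift.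
have ptsr q i : pts q (rshift n i) = (sol_lam (val q).1)`_i.+1 by rewrite /pts split_rshift.
exists pts; split=> [q1 q2 e|q k].
  have ex j : xq q1 j = xq q2 j by rewrite -!ptsl e.
  have x0 q j : (xq q j != 0) = (j \in (val q).1).
    rewrite /xq; case: ifP => _; last by rewrite eqxx.
    by case: ifP; rewrite ?oppr_eq0 s0.
  have eJ : (val q1).1 = (val q2).1 by apply/setP => j; rewrite -!x0 ex.
  have xS q j : (xq q j == - s (val q).1 j) = (j \in (val q).2).
    have /andP[_ /fintype.subsetP SJ] := valP q; rewrite /xq.
    have [jJ|jJ] := boolP (j \in (val q).1); last first.
      by rewrite eq_sym oppr_eq0 (negbTE (s0 _ _)); apply/esym/negP => /SJ; apply/negP.
    case: ifP => _; first by rewrite eqxx.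
    by rewrite -addr_eq0 -mulr2n -mulr_natr mulf_eq0 (negbTE (s0 _ _)) (negbTE char2).
  have eS : (val q1).2 = (val q2).2 by apply/setP => j; rewrite -!xS ex eJ.
  by apply: val_inj; rewrite [LHS]surjective_pairing [RHS]surjective_pairing eJ eS.
have /andP[/eqP cJ _] := valP q.
have lamE z : (lam_at n m z).@[pts q] = (sol_lam (val q).1).[z].
  rewrite (horner_coef_wide _ (size_sol_lam cJ)) big_ord_recl sol_lam0 mul1r.
  rewrite /lam_at mevalD meval1 raddf_sum /=; congr (_ + _).
  by apply: eq_bigr => i _; rewrite mevalZ mevalXU ptsr mulrC.
rewrite /model; case: (split_ordP k) => [j _|i _]; last first.
  rewrite /quad_at mevalB mevalC raddf_sum /=; apply/eqP.
  rewrite subr_eq0; apply/eqP.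
  have sv : (size ('X ^+ i.+1 : {poly K}) <= m.+1)%N by rewrite size_polyXn ltnS.
  have v0 : ('X ^+ i.+1 : {poly K}).[0] = 0 by rewrite hornerXn expr0n.
  rewrite -(lagrange_tau cJ sv v0) [RHS]big_mkcond /=; apply: eq_bigr => j _.
  rewrite mevalZ rmorphXn /= mevalXU ptsl /xq.
  case: ifP => _; last by rewrite expr0n mulr0.
  by case: ifP => _; rewrite ?sqrrN sE.
rewrite mevalZ mevalM mevalXU ptsl lamE /xq.
have [jJ|jJ] := boolP (j \in (val q).1); last by rewrite mul0r mulr0.
by rewrite sol_lam_root // !mulr0.
Qed.

(** Finiteness gives a bidegree whose monomials span modulo F; the estimate
    [rank_macaulay_bound] compares F with the model there. *)
Lemma bezout_upper (F : 'I_(n + m) -> {mpoly K[n + m]}) (N : nat)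
    (pts : 'I_N -> 'I_(n + m) -> K) :
  (forall d : K -> nat, exists e, infinite_set [set c | d c = e]) ->
  shape F ->
  finite_set [set z : 'rV[K]_(n + m) | forall k, (F k).@[z 0] = 0] ->
  (forall k l, pts k =1 pts l -> k = l) ->
  (forall k i, (F i).@[pts k] = 0) ->
  (N <= 2 ^ m * 'C(n, m))%N.
Proof.
move=> unc sF fin inj F0.
have [d dP] := finite_zeros_bounded unc fin.
pose a := maxn (2 * m) d; pose b := maxn 1 d.
have sp : spans (@col_mon n m a b) F.
  move=> g; have [g' [h hE] g'd] := dP g.
  exists (fun j => g'@_(col_mon j)), h.
  rewrite -hE -(bideg_supported (a := a) (b := b)) ?(addrC _ (g - g')) ?subrK //.
  move=> mo /g'd; rewrite mdeg_split => le; rewrite /a /b.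
  by apply/andP; split; lia.
have := rank_macaulay_bound (@row_mon_supported n m a b K) (shape_fits sF)
  (shape_fits (@model_shape K n m t tau)) inj F0 sp.
have b1 : (0 < b)%N by rewrite /b; lia.
have a2m : (2 * m <= a)%N by rewrite /a; lia.
move=> /leq_trans/(_ (model_rank t_inj t0 tau0 taut char2 b1 a2m)).
by rewrite leq_add2l.
Qed.

(** The comparison of [bezout_upper] with the roles exchanged: the D zeros of
    the model force a corank at least D on all systems of the same shape. *)
Lemma rank_upper (F : 'I_(n + m) -> {mpoly K[n + m]}) a b :
  (0 < b)%N -> (2 * m <= a)%N -> shape F ->
  (\rank (macaulay_mx a b F) + 2 ^ m * 'C(n, m) <= ncols n m a b)%N.
Proof.
move=> b1 a2m sF; have [pts [pts_inj pts0]] := model_zeros.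
rewrite -card_sol_index.
apply: (@rank_macaulay_bound _ _ _ _ _ _ _ (@row_mon_supported n m a b K) model F
  (shape_fits (@model_shape K n m t tau)) (shape_fits sF) _ (fun i => pts (enum_val i))).
- by move=> k l /pts_inj/enum_val_inj.
- by move=> k i; apply: pts0.
- exact: model_spans.
Qed.
End ModelZeros.

(** * Univariate representation of the zeros *)

Definition powers_mx (K : comNzRingType) n m D (u : {mpoly K[n + m]}) a b :
  'M[K]_(D, ncols n m a b) := \matrix_(k < D) coef_row a b (u ^+ k).

Section Univariate.
Variables (K : fieldType) (n m D : nat).
Variables (F : 'I_(n + m) -> {mpoly K[n + m]}) (u : {mpoly K[n + m]}).
Hypotheses (sF : shape F) (bu : bideg 1 1 u).
Implicit Types (mo : 'X_{1..n + m}) (g : {mpoly K[n + m]}).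

Local Notation powers_mx := (powers_mx D u).

(** The first D powers of u span in bidegree (a, b), modulo multiples of the
    equations that do not leave this bidegree. *)
Definition spanning_powers a b := row_full (macaulay_mx a b F + powers_mx a b)%MS.

Lemma powers_decomp a b g : (D <= a)%N -> (D <= b)%N -> spanning_powers a b ->
  bideg a b g -> exists c d, g =
    \sum_i c i *: ('X_[@row_mon n m a b i] * F (@row_eqn n m a b i)) + \sum_(k < D) d k *: u ^+ k.
Proof.
move=> Da Db sp bg.
have /sub_addsmxP[[c d] /= gE] : (coef_row a b g <= macaulay_mx a b F + powers_mx a b)%MS.
  exact: submx_full.
exists (fun i => c 0 i), (fun k => d 0 k).
apply: (coef_row_inj bg).
  apply: bidegD; apply: bideg_sum => i _; apply: bidegZ; first exact: shape_row.
  by apply: (bideg_pow bu); apply: ltnW; apply: leq_trans (ltn_ord i) _.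
rewrite gE linearD !linear_sum /= !mulmx_sum_row; congr (_ + _).
  apply: eq_bigr => i _; rewrite linearZ /=; congr (_ *: _).
  by apply/rowP => j; rewrite !mxE.
by apply: eq_bigr => k _; rewrite linearZ /= rowK.
Qed.

Lemma powers_sub a b k : (k < D)%N ->
  (coef_row a b (u ^+ k) <= macaulay_mx a b F + powers_mx a b)%MS.
Proof.
move=> lt; apply: submx_trans (addsmxSr _ _).
by rewrite (_ : coef_row _ _ _ = row (Ordinal lt) (powers_mx a b)) ?row_sub // rowK.
Qed.

Lemma macaulay_sub a b k mo : (xdeg mo + eqn_xdeg k <= a)%N -> (ldeg mo + eqn_ldeg k <= b)%N ->
  (coef_row a b ('X_[mo] * F k) <= macaulay_mx a b F + powers_mx a b)%MS.
Proof. by move=> ha hb; apply: submx_trans (addsmxSl _ _); apply: coef_row_macaulay. Qed.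

Lemma powers_transfer a b a' b' g : (D <= a)%N -> (D <= b)%N ->
  spanning_powers a b -> bideg a b g -> (a <= a')%N -> (b <= b')%N ->
  (coef_row a' b' g <= macaulay_mx a' b' F + powers_mx a' b')%MS.
Proof.
move=> Da Db sp bg la lb; have [c [d ->]] := powers_decomp Da Db sp bg.
rewrite linearD !linear_sum addmx_sub //; apply: summx_sub => i _ /=;
  rewrite linearZ; apply: scalemx_sub; last exact: powers_sub.
by have /andP[? ?] := row_mon_bound i; apply: macaulay_sub; [exact: leq_trans la | exact: leq_trans lb].
Qed.

Lemma powers_step a b a' b' mo k : (D <= a)%N -> (D <= b)%N ->
  spanning_powers a b -> (xdeg mo <= a)%N -> (ldeg mo <= b)%N ->
  (a + xdeg U_(k)%MM <= a')%N -> (b + ldeg U_(k)%MM <= b')%N ->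
  (xdeg U_(k)%MM <= 1)%N -> (ldeg U_(k)%MM <= 1)%N ->
  (coef_row a' b' ('X_[U_(k) + mo]) <= macaulay_mx a' b' F + powers_mx a' b')%MS.
Proof.
move=> Da Db sp ha hb la lb k1 k2; rewrite mpolyXD.
have [c [d ->]] := powers_decomp Da Db sp (@bidegX n m K _ _ _ ha hb).
rewrite mulrDr !mulr_sumr linearD !linear_sum addmx_sub //;
  apply: summx_sub => i _ /=; rewrite -scalerAr linearZ; apply: scalemx_sub.
  rewrite mulrA -mpolyXD; have /andP[? ?] := row_mon_bound i.
  by apply: macaulay_sub; rewrite bidegE; lia.
apply: powers_transfer sp _ _ _; rewrite // ?(leq_trans _ la) ?(leq_trans _ lb) ?leq_addr //.
have lt := ltn_ord i.
apply: (bidegW (a := 1 + i) (b := 1 + i)); try lia.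
by apply: bidegM; [apply: bidegX | apply: (bideg_pow bu)].
Qed.

(** A power of u of exponent less than D times a variable has bidegree at most
    (D, D), where the property is already known; so the property passes from one
    bidegree to the next. *)
Lemma powers_grow a b : (D <= a)%N -> (D <= b)%N -> spanning_powers a b ->
  spanning_powers a.+1 b /\ spanning_powers a b.+1.
Proof.
move=> Da Db sp; split; apply: coef_row_full => mo ha hb.
  have [le|gt] := leqP (xdeg mo) a.
    by apply: powers_transfer sp (@bidegX n m K _ _ _ le hb) _ _.
  have [j jm] : exists j, mo (lshift m j) != 0%N.
    apply/existsP; apply: contraTT gt; rewrite negb_exists => /forallP h.
    by rewrite -leqNgt /xdeg big1 // => j _; have := h j; rewrite negbK => /eqP.
  have le : (U_(lshift m j) <= mo)%MM by rewrite lep1mP.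
  have e := submK le; rewrite -e addmC.
  have := congr1 (@xdeg n m) e; have := congr1 (@ldeg n m) e; rewrite !bidegE => e1 e2.
  by apply: powers_step sp _ _ _ _ _ _; rewrite ?bidegE //; lia.
have [le|gt] := leqP (ldeg mo) b.
  by apply: powers_transfer sp (@bidegX n m K _ _ _ ha le) _ _.
have [j jm] : exists j, mo (rshift n j) != 0%N.
  apply/existsP; apply: contraTT gt; rewrite negb_exists => /forallP h.
  by rewrite -leqNgt /ldeg big1 // => j _; have := h j; rewrite negbK => /eqP.
have le' : (U_(rshift n j) <= mo)%MM by rewrite lep1mP.
have e := submK le'; rewrite -e addmC.
have := congr1 (@xdeg n m) e; have := congr1 (@ldeg n m) e; rewrite !bidegE => e1 e2.
by apply: powers_step sp _ _ _ _ _ _; rewrite ?bidegE //; lia.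
Qed.

Variables a b : nat.
Hypotheses (Da : (D <= a)%N) (Db : (D <= b)%N) (a1 : (0 < a)%N) (b1 : (0 < b)%N).
Hypothesis sp : spanning_powers a b.
Hypothesis rank_le : forall a' b', (a <= a')%N -> (b <= b')%N ->
  (\rank (macaulay_mx a' b' F) + D <= ncols n m a' b')%N.

Lemma powers_all i j : spanning_powers (i + a) (j + b).
Proof.
have Dja k : (D <= k + a)%N := leq_trans Da (leq_addl _ _).
have Djb k : (D <= k + b)%N := leq_trans Db (leq_addl _ _).
elim: i => [|i IH]; last by have [] := powers_grow (Dja i) (Djb j) IH.
elim: j => [|j IH] //; by have [] := powers_grow (Dja 0%N) (Djb j) IH.
Qed.

(** A polynomial relation for u belongs to the row space of the Macaulay matrix
    in a large bidegree. There the matrix has corank at least D, and D powers of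
    u complete it to full rank, hence are independent of it. *)
Lemma powers_independent (Q : {poly K}) : (size Q <= D)%N ->
  generated F (subst u Q) -> Q = 0.
Proof.
move=> sQ /(generated_macaulay sF)[d dP].
pose a' := (d + a)%N; pose b' := (d + b)%N.
have full : spanning_powers a' b' := powers_all d d.
have r1 : (\rank (macaulay_mx a' b' F) + D <= ncols n m a' b')%N.
  by apply: rank_le; rewrite leq_addl.
have := mxrank_sum_cap (macaulay_mx a' b' F) (powers_mx a' b').
rewrite (eqP full) => e.
have r2 : (\rank (powers_mx a' b') <= D)%N := rank_leq_row _.
have cap0 : \rank (macaulay_mx a' b' F :&: powers_mx a' b')%MS = 0%N by lia.
have free : row_free (powers_mx a' b').
  by rewrite /row_free eqn_leq r2 /=; lia.
have QE : coef_row a' b' (subst u Q) = (\row_k Q`_k) *m powers_mx a' b'.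
  rewrite mulmx_sum_row {1}/subst (horner_coef_wide _ (n := D)); last first.
    exact: leq_trans (size_poly _ _) sQ.
  rewrite linear_sum; apply: eq_bigr => k _ /=.
  by rewrite coef_map mul_mpolyC linearZ /= rowK mxE.
have : ((\row_k Q`_k) *m powers_mx a' b' <= macaulay_mx a' b' F :&: powers_mx a' b')%MS.
  by rewrite sub_capmx submxMl -QE dP ?leq_addr.
move/eqP: cap0; rewrite mxrank_eq0 => /eqP->; rewrite submx0 => /eqP z0.
have /rowP r0 : \row_k Q`_k = 0 :> 'rV_D.
  by apply: (row_free_inj free); rewrite /= z0 mul0mx.
apply/polyP => k; rewrite coef0; have [lt|ge] := ltnP k D.
  by have := r0 (Ordinal lt); rewrite !mxE.
by rewrite nth_default // (leq_trans sQ).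
Qed.

Variable Pt : {poly K}.
Hypotheses (sPt : size Pt = D.+1) (gPt : generated F (subst u Pt)).

(** Each coordinate is congruent to a polynomial r i in u. Substituting r in an
    element of the ideal gives a polynomial Q with Q(u) in the ideal, hence a
    multiple of Pt by [powers_independent]. So r maps the roots of Pt to
    zeros, and u recovers the root from the zero. *)
Lemma univariate : exists r : 'I_(n + m) -> {poly K},
  (forall z, (forall k, (F k).@[z] = 0) ->
     root Pt u.@[z] /\ forall i, z i = (r i).[u.@[z]]) /\
  (forall s, root Pt s -> (forall k, (F k).@[fun i => (r i).[s]] = 0) /\
     u.@[fun i => (r i).[s]] = s).
Proof.
have rE i : exists r : {poly K}, generated F ('X_i - subst u r).
  have bX : bideg a b ('X_i : {mpoly K[n + m]}).
    have : (xdeg U_(i)%MM + ldeg U_(i)%MM = 1)%N by rewrite -(@mdeg_split n m) mdeg1.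
    by move=> e; apply: bidegX; lia.
  have [c [d XE]] := powers_decomp Da Db sp bX.
  exists (\sum_(k < D) d k *: 'X^k).
  rewrite [X in X - _]XE rmorph_sum /=.
  under [X in _ - X]eq_bigr do rewrite substZ rmorphXn /= substX.
  rewrite addrK; apply: generated_sum => k _.
  by apply/generatedZ/generatedM/generated_mem.
have [r rP] : exists r : 'I_(n + m) -> {poly K}, forall i, generated F ('X_i - subst u (r i)).
  by move: rE => /fin_all_exists.
exists r.
pose ev g : {poly K} := mmap (@polyC K) r g.
have evE g s : (ev g).[s] = g.@[fun i => (r i).[s]].
  rewrite /ev; elim/mpolyind: g => [|c mo g _ _ IH].
    by rewrite raddf0 meval0 horner0.
  rewrite raddfD /= mmapZ mmapX mevalD mevalZ mevalX hornerD hornerM hornerC IH.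
  congr (_ * _ + _); rewrite /mmap1 horner_prod; apply: eq_bigr => i _.
  by rewrite horner_exp.
have gev g : generated F (g - subst u (ev g)).
  rewrite /ev; elim/mpolyind: g => [|c mo g _ _ IH].
    by rewrite raddf0 rmorph0 subrr; apply: generated0.
  rewrite raddfD rmorphD /= mmapZ mmapX rmorphM /= substC opprD addrACA.
  apply: generatedD => //; rewrite mul_mpolyC -scalerBr; apply: generatedZ.
  rewrite mpolyXE_id /mmap1 rmorph_prod /=.
  elim/big_ind2: _ => [|x2 x1 y2 y1 h1 h2|i _].
  - by rewrite subrr; apply: generated0.
  - have -> : x1 * y1 - x2 * y2 = y1 * (x1 - x2) + x2 * (y1 - y2) by ring.
    by apply: generatedD; apply: generatedM.
  rewrite rmorphXn /=; elim: (mo i) => [|e IHe].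
    by rewrite !expr0 subrr; apply: generated0.
  rewrite !exprS; set x := 'X_i ^+ e in IHe *; set y := _ ^+ e in IHe *.
  have -> : 'X_i * x - subst u (r i) * y
     = x * ('X_i - subst u (r i)) + subst u (r i) * (x - y) by ring.
  by apply: generatedD; apply: generatedM.
have Pt0 : Pt != 0 by rewrite -size_poly_gt0 sPt.
have dvd Q : generated F (subst u Q) -> Pt %| Q.
  move=> gQ; rewrite /dvdp; apply/eqP; apply: powers_independent.
    by rewrite -ltnS -sPt ltn_modp.
  have -> : Q %% Pt = Q - Q %/ Pt * Pt by rewrite {2}(divp_eq Q Pt) addrAC subrr add0r.
  rewrite rmorphB rmorphM /=; apply: generatedB => //.
  exact: generatedM.
have rootdvd Q s : generated F (subst u Q) -> root Pt s -> Q.[s] = 0.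
  by move=> /dvd/dvdpP[q ->] /eqP rs; rewrite hornerM rs mulr0.
split=> [z Fz|s rs].
  split; first by rewrite rootE -meval_subst (generated_zero Fz gPt).
  move=> i; have := generated_zero Fz (rP i).
  by rewrite mevalB mevalXU meval_subst => /subr0_eq.
split=> [k|].
  rewrite -evE; apply: (rootdvd _ _ _ rs).
  have -> : subst u (ev (F k)) = F k - (F k - subst u (ev (F k))) by ring.
  by apply: generatedB; [exact: generated_mem | exact: gev].
apply/eqP; rewrite -subr_eq0 -evE -[X in _ - X]hornerX -hornerN -hornerD; apply/eqP.
apply: (rootdvd _ _ _ rs); rewrite rmorphB /= substX -opprB -scaleN1r.
exact/generatedZ/gev.
Qed.
End Univariate.

(** * The eliminant *)

Section Eliminant.
Variables (n m D a b : nat).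
Local Notation p := (ncols n m a b).
Local Notation r := (nrows n m a b).
Variable sel : 'I_p -> 'I_(r + D).

Section Ring.
Variables (K : comNzRingType) (F : 'I_(n + m) -> {mpoly K[n + m]}) (u : {mpoly K[n + m]}).

(** The Macaulay matrix followed by the D first powers of u; [sel] selects a
    square submatrix. *)
Definition stack : 'M[K]_(r + D, p) := col_mx (macaulay_mx a b F) (powers_mx D u a b).

Definition selected : 'M[K]_p := rowsub sel stack.

(** Coefficients, given by Cramer's rule, of det * u ^ D on the selected rows. *)
Definition elim_coef : 'rV[K]_p := coef_row a b (u ^+ D) *m \adj selected.

Definition power_part (i : 'I_(r + D)) : {poly K} :=
  if fintype.split i is inr k then 'X^k else 0.

(** The relation between det * u ^ D and the selected rows, read modulo the
    equations: only the rows that are powers of u remain. *)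
Definition eliminant : {poly K} :=
  \det selected *: 'X^D - \sum_j elim_coef 0 j *: power_part (sel j).

Lemma size_power_sum : (size (\sum_j elim_coef 0 j *: power_part (sel j))%R <= D)%N.
Proof.
apply: leq_trans (size_sum _ _ _) _; apply/bigmax_leqP => j _.
apply: leq_trans (size_scale_leq _ _) _; rewrite /power_part.
by case: (fintype.split _) => [_|k]; rewrite ?size_poly0 ?size_polyXn.
Qed.

Lemma eliminant_lead : eliminant`_D = \det selected.
Proof.
rewrite coefB coefZ coefXn eqxx mulr1 [X in _ - X]nth_default ?subr0 //.
exact: size_power_sum.
Qed.

Lemma size_eliminant : \det selected != 0 -> size eliminant = D.+1.
Proof.
move=> d0; apply/eqP; rewrite eqn_leq; apply/andP; split.
  apply: leq_trans (size_polyD _ _) _; rewrite size_polyN geq_max.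
  rewrite (leq_trans size_power_sum) // andbT.
  by apply: leq_trans (size_scale_leq _ _) _; rewrite size_polyXn.
rewrite ltnNge; apply/negP => le; move: d0; rewrite -eliminant_lead.
by rewrite nth_default ?eqxx.
Qed.

Lemma size_eliminant_deriv : D%:R * \det selected != 0 -> size eliminant^`() = D.
Proof.
move=> Dd0; have d0 : \det selected != 0.
  by apply: contraNneq Dd0 => ->; rewrite mulr0.
have sE := size_eliminant d0.
have D0 : (0 < D)%N by case: (D) Dd0; rewrite // mul0r eqxx.
apply/eqP; rewrite eqn_leq; apply/andP; split.
  by rewrite -ltnS -sE; apply: lt_size_deriv; rewrite -size_poly_gt0 sE.
rewrite leqNgt; apply/negP => lt.
have : eliminant^`()`_D.-1 = 0 by rewrite nth_default // -ltnS prednK.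
rewrite coef_deriv prednK // eliminant_lead => e.
by move: Dd0; rewrite -mulr_natl in e; rewrite e eqxx.
Qed.

Hypotheses (sF : shape F) (bu : bideg 1 1 u) (Da : (D <= a)%N) (Db : (D <= b)%N).

Definition stack_poly (i : 'I_(r + D)) : {mpoly K[n + m]} :=
  match fintype.split i with
  | inl i => 'X_[@row_mon n m a b i] * F (@row_eqn n m a b i)
  | inr k => u ^+ k
  end.

Lemma stack_polyE i : bideg a b (stack_poly i) /\ coef_row a b (stack_poly i) = row i stack.
Proof.
rewrite /stack_poly /stack; case: fintype.split_ordP => [k ->|k ->].
  rewrite rowKu; split; first exact: shape_row.
  by apply/rowP => j; rewrite !mxE.
rewrite rowKd rowK; split=> //.
have le := ltnW (ltn_ord k).
exact: bideg_pow bu (leq_trans le Da) (leq_trans le Db).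
Qed.

Lemma eliminant_generated : generated F (subst u eliminant).
Proof.
have E : \det selected *: u ^+ D = \sum_j elim_coef 0 j *: stack_poly (sel j).
  apply: (@coef_row_inj n m K a b).
  - by apply: bidegZ; apply: (bideg_pow bu).
  - apply: bideg_sum => j _; apply: bidegZ; exact: (stack_polyE (sel j)).1.
  rewrite linearZ linear_sum /=.
  have -> : \sum_j coef_row a b (elim_coef 0 j *: stack_poly (sel j)) = elim_coef *m selected.
    rewrite mulmx_sum_row; apply: eq_bigr => j _; rewrite linearZ /=.
    by rewrite (stack_polyE _).2 row_rowsub.
  by rewrite /elim_coef -mulmxA mul_adj_mx mul_mx_scalar.
rewrite /eliminant rmorphB /= substZ rmorphXn /= substX E rmorph_sum -sumrB.
apply: generated_sum => j _ /=; rewrite substZ -scalerBr; apply: generatedZ.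
rewrite /stack_poly /power_part; case: (fintype.split _) => [i|k].
  by rewrite rmorph0 subr0; apply/generatedM/generated_mem.
by rewrite rmorphXn /= substX subrr; apply: generated0.
Qed.
End Ring.

Section Map.
Variables (K K' : comNzRingType) (th : {rmorphism K -> K'}).
Variables (F : 'I_(n + m) -> {mpoly K[n + m]}) (u : {mpoly K[n + m]}).
Local Notation F' := (fun k => map_mpoly th (F k)).

Lemma map_coef_row (g : {mpoly K[n + m]}) : map_mx th (coef_row a b g) = coef_row a b (map_mpoly th g).
Proof. by apply/rowP => j; rewrite !mxE mcoeff_map_mpoly. Qed.

Lemma map_stack : map_mx th (stack F u) = stack F' (map_mpoly th u).
Proof.
rewrite /stack map_col_mx; congr col_mx; apply/matrixP => i j.
  by rewrite !mxE -mcoeff_map_mpoly rmorphM /= map_mpolyX.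
by rewrite !mxE -mcoeff_map_mpoly rmorphXn.
Qed.

Lemma map_selected : map_mx th (selected F u) = selected F' (map_mpoly th u).
Proof. by rewrite /selected -map_stack; apply/matrixP => i j; rewrite !mxE. Qed.

Lemma map_eliminant : map_poly th (eliminant F u) = eliminant F' (map_mpoly th u).
Proof.
rewrite /eliminant rmorphB rmorph_sum /= map_polyZ map_polyXn -det_map_mx map_selected.
congr (_ - _); apply: eq_bigr => j _; rewrite map_polyZ; congr (_ *: _).
  rewrite /elim_coef -map_selected -map_mx_adj -rmorphXn /= -map_coef_row.
  by rewrite -map_mxM [RHS]mxE.
rewrite /power_part; case: (fintype.split _) => [i|k]; first by rewrite rmorph0.
by rewrite map_polyXn.
Qed.
End Map.

Lemma selected_spanning (K : fieldType) (F : 'I_(n + m) -> {mpoly K[n + m]}) u :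
  \det (selected F u) != 0 -> spanning_powers D F u a b.
Proof.
rewrite -unitfE -unitmxE -row_full_unit -sub1mx => full.
rewrite /spanning_powers -sub1mx addsmxE; apply: submx_trans full _.
exact: rowsub_sub.
Qed.

Section Count.
Variables (K : closedFieldType) (F : 'I_(n + m) -> {mpoly K[n + m]}) (u : {mpoly K[n + m]}).
Hypotheses (sF : shape F) (bu : bideg 1 1 u) (Da : (D <= a)%N) (Db : (D <= b)%N).
Hypotheses (a1 : (0 < a)%N) (b1 : (0 < b)%N).
Hypothesis rank_le : forall a' b', (a <= a')%N -> (b <= b')%N ->
  (\rank (macaulay_mx a' b' F) + D <= ncols n m a' b')%N.
Hypotheses (d0 : \det (selected F u) != 0).
Hypothesis sep : resultant (eliminant F u) (eliminant F u)^`() != 0.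

(** The nonzero resultant makes the eliminant separable, hence with D distinct
    roots, which [univariate] turns into the zeros. *)
Lemma zeros_count : exists s : seq 'rV[K]_(n + m), [/\ uniq s, size s = D &
  forall z : 'rV_(n + m), (forall k, (F k).@[z 0] = 0) <-> z \in s].
Proof.
pose P := eliminant F u.
have sP : size P = D.+1 := size_eliminant d0.
have P0 : P != 0 by rewrite -size_poly_gt0 sP.
have [rr [H1 H2]] := univariate sF bu Da Db a1 b1 (selected_spanning d0) rank_le sP
  (eliminant_generated sF bu Da Db).
have [rs PE] := closed_field_poly_normal P.
have lP0 : lead_coef P != 0 by rewrite lead_coef_eq0.
have rsP x : root P x = (x \in rs) by rewrite PE rootZ // root_prod_XsubC.
have szrs : size rs = D.
  by have := sP; rewrite PE size_scale // size_prod_XsubC => -[].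
have urs : uniq rs.
  rewrite -separable_prod_XsubC unlock.
  have : coprimep P P^`().
    move: sep; rewrite resultant_eq0 -leqNgt => le; rewrite /coprimep eqn_leq le.
    by rewrite size_poly_gt0 gcdp_eq0 negb_and P0.
  by rewrite {1 2}PE derivZ coprimepZl // coprimepZr.
pose kkt_point x : 'rV[K]_(n + m) := \row_i (rr i).[x].
have ptE x g : g.@[kkt_point x 0] = g.@[fun i => (rr i).[x]].
  by apply: meval_eq => i; rewrite mxE.
exists (map kkt_point rs); split.
- rewrite map_inj_in_uniq // => x y; rewrite -!rsP => /H2[_ xE] /H2[_ yE] e.
  by rewrite -xE -yE -!ptE e.
- by rewrite size_map.
move=> z; split=> [Fz|/mapP[x]].
  have [rz zE] := H1 _ Fz; apply/mapP; exists u.@[z 0]; first by rewrite -rsP.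
  by apply/rowP => i; rewrite mxE.
by rewrite -rsP => /H2[Fx _] -> k; rewrite ptE.
Qed.
End Count.

Section Nonzero.
Variables (K : fieldType) (F : 'I_(n + m) -> {mpoly K[n + m]}) (u : {mpoly K[n + m]}).
Hypotheses (sF : shape F) (bu : bideg 1 1 u) (Da : (D <= a)%N) (Db : (D <= b)%N).
Hypotheses (d0 : \det (selected F u) != 0).
Variable pts : 'I_D -> 'I_(n + m) -> K.
Hypotheses (Fz : forall q k, (F k).@[pts q] = 0) (u_inj : injective (fun q => u.@[pts q])).

(** The D values of u at the zeros are roots of the eliminant, whose degree is
    D, so all of its roots are simple. *)
Lemma eliminant_separable : resultant (eliminant F u) (eliminant F u)^`() != 0.
Proof.
pose P := eliminant F u.
have sP : size P = D.+1 := size_eliminant d0.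
have P0 : P != 0 by rewrite -size_poly_gt0 sP.
have lP0 : lead_coef P != 0 by rewrite lead_coef_eq0.
pose rs := [seq u.@[pts q] | q <- enum 'I_D].
have urs : uniq rs by rewrite map_inj_uniq ?enum_uniq.
have PE : P = lead_coef P *: \prod_(z <- rs) ('X - z%:P).
  apply: all_roots_prod_XsubC; rewrite ?uniq_rootsE //.
    by rewrite sP size_map size_enum_ord.
  apply/allP => _ /mapP[q _ ->]; rewrite rootE -meval_subst.
  by apply/eqP/(generated_zero (Fz q))/eliminant_generated.
rewrite resultant_eq0 -leqNgt -/P.
have : coprimep P P^`().
  rewrite {1 2}PE derivZ coprimepZl // coprimepZr //.
  by have := urs; rewrite -separable_prod_XsubC unlock.
by rewrite /coprimep => /eqP->.
Qed.
End Nonzero.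
End Eliminant.

(** The dimensions of the Sylvester matrix depend on the two sizes only. *)
Lemma map_resultant_eq_size (R R' : comNzRingType) (f : {rmorphism R -> R'}) (p q : {poly R}) :
  size (map_poly f p) = size p -> size (map_poly f q) = size q ->
  f (resultant p q) = resultant (map_poly f p) (map_poly f q).
Proof.
move=> sp sq; rewrite /resultant /Sylvester_mx sp sq -det_map_mx /= map_col_mx.
by congr (\det (col_mx _ _)); apply: map_lin1_mx => v;
  rewrite map_poly_rV rmorphM /= map_rVpoly.
Qed.

Section Stack.
Variables (K : fieldType) (n m D a b : nat).
Variables (F : 'I_(n + m) -> {mpoly K[n + m]}) (u : {mpoly K[n + m]}).
Hypotheses (sF : shape F) (bu : bideg 1 1 u) (Da : (D <= a)%N) (Db : (D <= b)%N).
Variable pts : 'I_D -> 'I_(n + m) -> K.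
Hypotheses (Fz : forall q k, (F k).@[pts q] = 0) (u_inj : injective (fun q => u.@[pts q])).
Hypothesis rk : (ncols n m a b <= \rank (macaulay_mx a b F) + D)%N.

(** At the points, the rows of the Macaulay matrix evaluate to 0 and the powers
    of u to a Vandermonde matrix; so their row spaces are in direct sum, which
    has full dimension. *)
Lemma selection_exists :
  exists sel : 'I_(ncols n m a b) -> 'I_(nrows n m a b + D), \det (selected sel F u) != 0.
Proof.
pose Ev : 'M[K]_(ncols n m a b, D) := \matrix_(j, q) ('X_[@col_mon n m a b j]).@[pts q].
have rowEv g : bideg a b g -> coef_row a b g *m Ev = \row_q g.@[pts q].
  move=> bg; apply/rowP => q; rewrite !mxE {2}(bideg_supported bg) raddf_sum /=.
  by apply: eq_bigr => j _; rewrite !mxE mevalZ.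
have macEv : macaulay_mx a b F *m Ev = 0.
  apply/row_matrixP => i; rewrite row_mul row0.
  have -> : row i (macaulay_mx a b F) = coef_row a b ('X_[@row_mon n m a b i] * F (@row_eqn n m a b i)).
    by apply/rowP => j; rewrite !mxE.
  rewrite rowEv; last exact: shape_row.
  by apply/rowP => q; rewrite !mxE mevalM Fz mulr0.
have powEv : row_free (powers_mx D u a b *m Ev).
  have -> : powers_mx D u a b *m Ev = Vandermonde D (\row_q u.@[pts q]).
    apply/row_matrixP => k; rewrite row_mul rowK rowEv; last first.
      apply: (bideg_pow bu); apply: ltnW; apply: leq_trans (ltn_ord k) _ => //.
    by apply/rowP => q; rewrite !mxE rmorphXn.
  rewrite row_free_unit unitmxE det_Vandermonde unitfE; apply/prodf_neq0 => i _.
  apply/prodf_neq0 => j lt; rewrite !mxE subr_eq0 (inj_eq u_inj).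
  by rewrite neq_ltn lt orbT.
have full : row_full (stack D a b F u).
  rewrite /row_full -addsmxE; apply/eqP/anti_leq; rewrite rank_leq_col /=.
  have := mxrank_sum_cap (macaulay_mx a b F) (powers_mx D u a b).
  have -> : \rank (macaulay_mx a b F :&: powers_mx D u a b)%MS = 0%N.
    apply/eqP; rewrite mxrank_eq0; apply/rowV0P => v; rewrite sub_capmx.
    case/andP=> /submxP[c1 v1] /submxP[c2 v2].
    have : c2 *m (powers_mx D u a b *m Ev) = 0.
      by rewrite mulmxA -v2 v1 -mulmxA macEv mulmx0.
    rewrite -(mul0mx _ (powers_mx D u a b *m Ev)) => /(row_free_inj powEv) c20.
    by rewrite v2 c20 mul0mx.
  have rp : \rank (powers_mx D u a b) = D.
    apply/eqP; rewrite eqn_leq rank_leq_row /= -{1}(eqP powEv).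
    exact: mxrankM_maxl.
  by rewrite rp addn0 => ->.
exists (fullrankfun full); have := fullrowsub_unit full.
by rewrite unitmxE unitfE.
Qed.
End Stack.

(** * KKT systems *)

Section Kkt.
Variables (n m : nat).

Section Ring.
Variable K : comNzRingType.
Variables (A : 'I_m.+1 -> 'M[K]_n) (B : 'I_m.+1 -> 'cV[K]_n) (c : 'I_m.+1 -> K).
Local Notation P := {mpoly K[n + m]}.

(** The objective has multiplier 1. *)
Definition multiplier (i : 'I_m.+1) : P :=
  if unlift ord0 i is Some i' then 'X_(rshift n i') else 1.

Definition kkt (k : 'I_(n + m)) : P :=
  match fintype.split k with
  | inl j => \sum_i multiplier i *
      (\sum_l (2 * A i j l) *: 'X_(lshift m l) + (B i j 0)%:MP)
  | inr i => \sum_j \sum_l A (lift ord0 i) j l *: ('X_(lshift m j) * 'X_(lshift m l))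
      + \sum_j B (lift ord0 i) j 0 *: 'X_(lshift m j) + (c (lift ord0 i))%:MP
  end.

Lemma kkt_shape : shape kkt.
Proof.
have bx j : bideg 1 0 ('X_(lshift m j) : P) := @bideg_x n m K j.
move=> k; rewrite /kkt /eqn_xdeg /eqn_ldeg; case: (fintype.split k) => [j|i].
  apply: bideg_sum => i _; have bm : bideg 0 1 (multiplier i).
    rewrite /multiplier; case: (unlift ord0 i) => [i'|]; first exact: bideg_lam.
    exact: bidegC.
  apply: (bidegM bm (a' := 1) (b' := 0)); apply: bidegD; last exact: bidegC.
  by apply: bideg_sum => l _; apply: bidegZ.
apply: bidegD; last exact: bidegC.
apply: bidegD; apply: bideg_sum => j _.
  apply: bideg_sum => l _; apply: bidegZ; exact: (bidegM (@bx j) (@bx l)).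
by apply: bidegZ; apply: bidegW (@bx j).
Qed.
End Ring.

Lemma map_kkt (K K' : comNzRingType) (th : {rmorphism K -> K'})
    (A : 'I_m.+1 -> 'M[K]_n) (B : 'I_m.+1 -> 'cV[K]_n) (c : 'I_m.+1 -> K)
    (A' : 'I_m.+1 -> 'M[K']_n) (B' : 'I_m.+1 -> 'cV[K']_n) (c' : 'I_m.+1 -> K') k :
  (forall i j l, th (A i j l) = A' i j l) -> (forall i j, th (B i j 0) = B' i j 0) ->
  (forall i, th (c i) = c' i) ->
  map_mpoly th (kkt A B c k) = kkt A' B' c' k.
Proof.
move=> HA HB Hc; rewrite /kkt; case: (fintype.split k) => [j|i].
  rewrite rmorph_sum; apply: eq_bigr => i _.
  rewrite rmorphM rmorphD rmorph_sum /= map_mpolyC.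
  congr (_ * (_ + _%:MP)); last exact: HB.
    rewrite /multiplier; case: (unlift ord0 i) => [i'|]; last by rewrite rmorph1.
    by rewrite map_mpolyX.
  apply: eq_bigr => l _; rewrite map_mpolyZ map_mpolyX; congr (_ *: _).
  by rewrite rmorphM rmorph_nat -HA.
rewrite !rmorphD /= map_mpolyC !rmorph_sum /=; congr (_ + _ + _%:MP); last exact: Hc.
  apply: eq_bigr => j _; rewrite rmorph_sum; apply: eq_bigr => l _.
  by rewrite /= map_mpolyZ rmorphM /= !map_mpolyX; congr (_ *: _); exact: HA.
by apply: eq_bigr => j _; rewrite map_mpolyZ map_mpolyX; congr (_ *: _); exact: HB.
Qed.
End Kkt.

Section Quadratic.
Variables (K : comNzRingType) (n : nat) (A : 'M[K]_n) (b : 'cV[K]_n) (c : K).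

Definition qpoly : {mpoly K[n]} :=
  \sum_(i < n) \sum_(j < n) A i j *: ('X_i * 'X_j) + \sum_(i < n) b i 0 *: 'X_i + c%:MP.

Lemma mpeval_qpoly x : mpeval qpoly x =
  \sum_i \sum_j A i j * (x i 0 * x j 0) + \sum_i b i 0 * x i 0 + c.
Proof.
rewrite /mpeval /qpoly !mevalD mevalC !raddf_sum /=; congr (_ + _ + _).
  apply: eq_bigr => i _; rewrite raddf_sum; apply: eq_bigr => j _ /=.
  by rewrite mevalZ mevalM !mevalXU.
by apply: eq_bigr => i _; rewrite mevalZ mevalXU.
Qed.

Lemma mderivXU (i j : 'I_n) : ('X_i : {mpoly K[n]})^`M(j) = (i == j)%:R%:MP.
Proof.
rewrite mderivX mnm1E; case: eqP => [->|_]; last by rewrite scale0r mpolyC0.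
rewrite scale1r (_ : (U_(j) - U_(j))%MM = 0%MM) ?mpolyX0 //.
by apply/mnmP => k; rewrite mnmBE subnn mnm0E.
Qed.

Lemma grad_qpoly x j : A^T = A ->
  grad qpoly x j 0 = \sum_l 2 * A j l * x l 0 + b j 0.
Proof.
move=> symA; rewrite /grad mxE /mpeval /qpoly !mderivD mderivC addr0.
rewrite mevalD !(raddf_sum (mderiv j)) !(raddf_sum (meval _)) /=; congr (_ + _); last first.
  rewrite (bigD1 j) //= mderivZ mderivXU eqxx mevalZ mevalC mulr1.
  rewrite big1 ?addr0 // => i ni.
  by rewrite mderivZ mderivXU (negbTE ni) mevalZ mevalC mulr0.
have pick (F : 'I_n -> K) : \sum_i (i == j)%:R * F i = F j.
  rewrite (bigD1 j) //= eqxx mul1r big1 ?addr0 // => i ni.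
  by rewrite (negbTE ni) mul0r.
transitivity (\sum_i ((i == j)%:R * (\sum_l A i l * x l 0)
    + \sum_l (l == j)%:R * (A i l * x i 0))).
  apply: eq_bigr => i _; rewrite (raddf_sum (mderiv j)) (raddf_sum (meval _)).
  rewrite mulr_sumr -big_split; apply: eq_bigr => l _ /=.
  by rewrite mderivZ mderivM !mderivXU mevalZ mevalD !mevalM !mevalXU !mevalC; ring.
rewrite big_split /= (pick (fun i => \sum_l A i l * x l 0)).
under [X in _ + X]eq_bigr => i _ do rewrite (pick (fun l => A i l * x i 0)).
rewrite -big_split /=; apply: eq_bigr => l _.
by rewrite -[in A l j]symA mxE; ring.
Qed.
End Quadratic.

Section Solutions.
Variables (R : realType) (n m : nat).
Local Notation C := R[i].
Local Notation rc := (real_complex R).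
Implicit Types f : 'I_m.+1 -> quadratic R n.

Definition complex_kkt f : 'I_(n + m) -> {mpoly C[n + m]} :=
  kkt (fun i => map_mx rc (quad_mx (f i))) (fun i => map_mx rc (quad_lin (f i)))
    (fun i => rc (quad_cst (f i))).

Definition kkt_point (z : 'cV[C]_n * 'cV[C]_m) : 'rV[C]_(n + m) := row_mx z.1^T z.2^T.

Definition kkt_unpoint (v : 'rV[C]_(n + m)) : 'cV[C]_n * 'cV[C]_m :=
  ((lsubmx v)^T, (rsubmx v)^T).

Lemma kkt_pointK : cancel kkt_point kkt_unpoint.
Proof. by move=> [x y]; rewrite /kkt_unpoint /kkt_point /= row_mxKl row_mxKr !trmxK. Qed.

Lemma kkt_unpointK : cancel kkt_unpoint kkt_point.
Proof. by move=> v; rewrite /kkt_unpoint /kkt_point /= !trmxK hsubmxK. Qed.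

Lemma kkt_pointl z j : kkt_point z 0 (lshift m j) = z.1 j 0.
Proof. by rewrite /kkt_point row_mxEl mxE. Qed.

Lemma kkt_pointr z i : kkt_point z 0 (rshift n i) = z.2 i 0.
Proof. by rewrite /kkt_point row_mxEr mxE. Qed.

Lemma complex_polyE (q : quadratic R n) : complex_poly q =
  qpoly (map_mx rc (quad_mx q)) (map_mx rc (quad_lin q)) (rc (quad_cst q)).
Proof.
rewrite /complex_poly /quad_poly /qpoly !rmorphD /= map_mpolyC !rmorph_sum /=.
congr (_ + _ + _).
  apply: eq_bigr => i _; rewrite rmorph_sum; apply: eq_bigr => j _ /=.
  by rewrite map_mpolyZ rmorphM /= !map_mpolyX mxE.
by apply: eq_bigr => i _; rewrite map_mpolyZ map_mpolyX mxE.
Qed.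

Lemma KKT_zeros f z : KKT_solutions f z <-> forall k, (complex_kkt f k).@[kkt_point z 0] = 0.
Proof.
have symC i : (map_mx rc (quad_mx (f i)))^T = map_mx rc (quad_mx (f i)).
  by rewrite map_trmx quad_mx_sym.
have gradE j : (complex_kkt f (lshift m j)).@[kkt_point z 0] =
  (grad (complex_poly (f ord0)) z.1
   + \sum_(i < m) z.2 i 0 *: grad (complex_poly (f (lift ord0 i))) z.1) j 0.
  rewrite /complex_kkt /kkt split_lshift big_ord_recl mevalD.
  rewrite [RHS]mxE complex_polyE grad_qpoly // summxE raddf_sum /=; congr (_ + _).
    rewrite /multiplier unlift_none mul1r mevalD mevalC raddf_sum /=; congr (_ + _).
    by apply: eq_bigr => l _; rewrite mevalZ mevalXU kkt_pointl.
  apply: eq_bigr => i _; rewrite [RHS]mxE complex_polyE grad_qpoly //.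
  rewrite /multiplier liftK mevalM mevalXU kkt_pointr mevalD mevalC raddf_sum /=.
  congr (_ * (_ + _)).
  by apply: eq_bigr => l _; rewrite mevalZ mevalXU kkt_pointl.
have consE i : (complex_kkt f (rshift n i)).@[kkt_point z 0]
   = mpeval (complex_poly (f (lift ord0 i))) z.1.
  rewrite /complex_kkt /kkt split_rshift complex_polyE mpeval_qpoly !mevalD mevalC.
  rewrite !raddf_sum /=; congr (_ + _ + _).
    apply: eq_bigr => j _; rewrite raddf_sum; apply: eq_bigr => l _ /=.
    by rewrite mevalZ mevalM !mevalXU !kkt_pointl.
  by apply: eq_bigr => j _; rewrite mevalZ mevalXU kkt_pointl.
split=> [[h1 h2] k|h].
  case: (fintype.split_ordP k) => [j ->|i ->]; last by rewrite consE h2.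
  by rewrite gradE h1 mxE.
split=> [|i]; last by rewrite -consE h.
by apply/colP => j; rewrite -gradE h mxE.
Qed.
End Solutions.

(** * Specialization of the universal KKT system *)

Section Separating.
Variables (K : numFieldType) (N D : nat) (pts : 'I_D -> 'I_N -> K).
Hypothesis pts_inj : forall q1 q2, pts q1 =1 pts q2 -> q1 = q2.

(** The weights are the powers of an integer s: two points are not separated
    only if s is a root of a nonzero polynomial. *)
Lemma separating_weights : exists w : 'I_N -> nat,
  injective (fun q => \sum_i (w i)%:R * pts q i).
Proof.
(* insub turns the index i < N back into an ordinal; its default 0 never occurs. *)
pose P q1 q2 : {poly K} := \poly_(i < N) (if insub i is Some i' then pts q1 i' - pts q2 i' else 0).
have PE q1 q2 x : (P q1 q2).[x] = \sum_(i < N) x ^+ i * pts q1 i - \sum_(i < N) x ^+ i * pts q2 i.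
  rewrite horner_poly -sumrB; apply: eq_bigr => i _.
  by rewrite valK mulrC mulrBr.
have P0 q1 q2 : q1 != q2 -> P q1 q2 != 0.
  apply: contra_neq => P0; apply: pts_inj => i.
  have := congr1 (fun p : {poly K} => p`_i) P0.
  by rewrite coef0 coef_poly ltn_ord valK => /subr0_eq.
pose Q := \prod_(q | q.1 != q.2) P q.1 q.2.
have Q0 : Q != 0 by apply/prodf_neq0 => q; apply: P0.
have [s sQ] : exists s : nat, Q.[s%:R] != 0.
  apply: contrapT => h.
  have rt : all (root Q) [seq k%:R | k <- iota 0 (size Q)].
    apply/allP => _ /mapP[k _ ->]; rewrite rootE; apply/negPn/negP => Qk.
    by apply: h; exists k.
  have := max_poly_roots Q0 rt; rewrite size_map size_iota ltnn => h1.
  have : false; last by [].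
  apply: h1; rewrite map_inj_uniq ?iota_uniq // => x y /eqP.
  by rewrite eqr_nat => /eqP.
exists (fun i : 'I_N => s ^ i)%N => q1 q2 e; apply/eqP; apply: contraNT sQ => nq.
rewrite /Q horner_prod; apply/prodf_eq0; exists (q1, q2) => //=.
rewrite PE subr_eq0; apply/eqP.
by move: e; under eq_bigr do rewrite natrX; under [X in _ = X -> _]eq_bigr do rewrite natrX.
Qed.
End Separating.

Section UniversalSystem.
Variables (R : realType) (n m : nat).
Local Notation C := R[i].
Local Notation rc := (real_complex R).
Local Notation M := (m.+1 * (n * n + (n + 1)))%N.
Local Notation T := {mpoly R[M]}.

(** The KKT system whose coefficients are indeterminates, numbered as in
    [tuple_coefs]. *)
Definition univ_kkt : 'I_(n + m) -> {mpoly T[n + m]} :=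
  kkt (fun i : 'I_m.+1 => \matrix_(j < n, l < n)
         ('X_(mxvec_index i (lshift (n + 1) (mxvec_index j l))) : T))
      (fun i => \col_(j < n) ('X_(mxvec_index i (rshift (n * n) (lshift 1 j))) : T))
      (fun i => 'X_(mxvec_index i (rshift (n * n) (rshift n ord0))) : T).

Definition specialize (f : 'I_m.+1 -> quadratic R n) : T -> C :=
  rc \o meval (tuple_coefs f 0).

HB.instance Definition _ f := GRing.RMorphism.copy (specialize f) (rc \o meval (tuple_coefs f 0)).

Lemma map_univ_kkt f k : map_mpoly (specialize f) (univ_kkt k) = complex_kkt f k.
Proof.
apply: map_kkt => [i j l|i j|i]; rewrite ?mxE /= /specialize /= mevalXU /tuple_coefs mxvecE mxE
  /quad_coefs ?row_mxEl ?row_mxEr ?row_mxEl ?mxvecE //.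
  by rewrite mxE.
by rewrite mxE eqxx.
Qed.
End UniversalSystem.

Section ModelQuad.
Variables (R : realType) (n m : nat).

(** The real quadratics behind [model], with t_j = j + 1 and tau = n + 1 (for j
    counted from 0). The index 0 is the objective, without constant term. *)
Definition model_quad (i : 'I_m.+1) : quadratic R n :=
  Quadratic 0 (if i == ord0 then 0 else - n.+1%:R ^+ i)
    (tr_diag_mx (\row_(j < n) (j.+1%:R ^+ i : R))).

Local Notation rc := (real_complex R).

Lemma model_quadE :
  complex_kkt model_quad = @model R[i] n m (fun j => j.+1%:R) n.+1%:R.
Proof.
have b0 i j : map_mx rc (quad_lin (model_quad i)) j 0 = 0.
  by rewrite mxE /= mxE rmorph0.
have Amx i j l : map_mx rc (quad_mx (model_quad i)) j l = (j.+1%:R ^+ i) *+ (j == l).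
  by rewrite mxE /= !mxE rmorphMn rmorphXn rmorph_nat.
apply: funext => k; rewrite /complex_kkt /kkt /model; case: (fintype.split k) => [j|i].
  have E (i : 'I_m.+1) : \sum_l (2 * (map_mx rc (quad_mx (model_quad i))) j l) *: 'X_(lshift m l)
      + (map_mx rc (quad_lin (model_quad i)) j 0)%:MP
     = (2 * j.+1%:R ^+ i) *: 'X_(lshift m j) :> {mpoly R[i][n + m]}.
    rewrite b0 mpolyC0 addr0 (bigD1 j) //= Amx eqxx mulr1n.
    by rewrite big1 ?addr0 // => l nl; rewrite Amx eq_sym (negbTE nl) mulr0n mulr0 scale0r.
  under eq_bigr do rewrite E.
  rewrite big_ord_recl /multiplier unlift_none mul1r expr0 mulr1.
  rewrite /lam_at mulrDr mulr1 scalerDr; congr (_ + _).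
  rewrite mulr_sumr scaler_sumr; apply: eq_bigr => i _; rewrite liftK lift0.
  rewrite -!scalerAr scalerA; congr (_ *: _); exact: mulrC.
rewrite /quad_at [X in _ + X + _]big1 ?addr0 => [|j _]; last by rewrite b0 scale0r.
congr (_ + _); last first.
  by rewrite /= hornerXn rmorphN rmorphXn rmorph_nat mpolyCN.
apply: eq_bigr => j _; rewrite (bigD1 j) // Amx eqxx mulr1n hornerXn.
rewrite big1 => [|l nl]; first by rewrite /= addr0 expr2.
by rewrite Amx eq_sym (negbTE nl) mulr0n scale0r.
Qed.
End ModelQuad.

(** * The algebraic degree *)

Section Main.
Variables (R : realType) (n m : nat).
Local Notation C := R[i].
Local Notation D := (2 ^ m * 'C(n, m))%N.

Let t (j : 'I_n) : C := j.+1%:R.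
Let tau : C := n.+1%:R.

Let t_inj : injective t.
Proof. by move=> i j /eqP; rewrite eqr_nat eqSS => /eqP /val_inj. Qed.

Let t0 j : t j != 0.
Proof. by rewrite pnatr_eq0. Qed.

Let tau0 : tau != 0.
Proof. by rewrite pnatr_eq0. Qed.

Let taut j : t j != tau.
Proof. by rewrite eqr_nat eqSS ltn_eqF. Qed.

Let char2 : 2 != 0 :> C.
Proof. by rewrite pnatr_eq0. Qed.

Lemma degree_upper (f : 'I_m.+1 -> quadratic R n) :
  finite_set (KKT_solutions f) -> (algebraic_degree f <= D)%N.
Proof.
move=> fin; rewrite /algebraic_degree; set S := fset_set _.
have SP z : z \in S -> KKT_solutions f z by rewrite in_fset_set // inE.
pose z0 : 'cV[C]_n * 'cV[C]_m := 0.
pose zs (k : 'I_(#|` S|)) := nth z0 (enum_fset S) k.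
have zsS k : zs k \in S by apply: mem_nth; apply: ltn_ord.
apply: (@bezout_upper _ _ _ t tau t_inj t0 tau0 taut char2 (complex_kkt f) _ (fun k => kkt_point (zs k) 0)).
- exact: infinite_fiber.
- exact: kkt_shape.
- apply: (@sub_finite_set _ _ [set kkt_point z | z in KKT_solutions f]); last exact: finite_image.
  move=> v vz; exists (kkt_unpoint v); last exact: kkt_unpointK.
  by apply/KKT_zeros; rewrite kkt_unpointK.
- move=> k l e; apply/val_inj/eqP; rewrite -(@nth_uniq _ z0 (enum_fset S)) ?fset_uniq ?ltn_ord //.
  by apply/eqP/(can_inj (@kkt_pointK R n m))/rowP => i; apply: e.
- by move=> k i; apply: (KKT_zeros f (zs k)).1; apply: SP.
Qed.

Lemma kkt_system_rank (F : 'I_(n + m) -> {mpoly C[n + m]}) a b :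
  (0 < b)%N -> (2 * m <= a)%N -> shape F ->
  (\rank (macaulay_mx a b F) + D <= ncols n m a b)%N.
Proof. exact: (rank_upper t_inj t0 tau0 taut char2). Qed.

Lemma degree_of_zeros (f : 'I_m.+1 -> quadratic R n) (s : seq 'rV[C]_(n + m)) :
  uniq s -> (forall z : 'rV_(n + m), (forall k, (complex_kkt f k).@[z 0] = 0) <-> z \in s) ->
  finite_set (KKT_solutions f) /\ algebraic_degree f = size s.
Proof.
move=> us sP.
have E : KKT_solutions f = [set` [fset z in map (@kkt_unpoint R n m) s]%fset].
  apply/seteqP; split=> z /=; rewrite !inE.
    by move=> /KKT_zeros/sP h; rewrite -(kkt_pointK z) map_f.
  case/mapP=> v vs ->; by apply/KKT_zeros; rewrite kkt_unpointK; apply/sP.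
split; first by rewrite E.
rewrite /algebraic_degree E set_fsetK card_fseq undup_id ?size_map //.
by rewrite map_inj_uniq //; apply/can_inj/kkt_unpointK.
Qed.

(** The open set is the complement of the zeros of one polynomial p in the
    coefficients: the Cramer determinant of the universal system times the
    resultant of its eliminant with its derivative. *)
Lemma generic_degree : (m <= n)%N ->
  exists U : set ('I_m.+1 -> quadratic R n),
    [/\ Zariski_open U, U !=set0 &
      forall f, U f -> finite_set (KKT_solutions f) /\ algebraic_degree f = D].
Proof.
move=> mn.
have D0 : (0 < D)%N by rewrite muln_gt0 expn_gt0 bin_gt0 mn.
have [pts0 [pts0_inj pts0z]] := model_zeros m t_inj t0 tau0 taut char2.
pose pts (q : 'I_D) := pts0 (enum_val (cast_ord (esym (card_sol_index n m)) q)).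
have pts_inj q1 q2 : pts q1 =1 pts q2 -> q1 = q2.
  by move=> /pts0_inj/enum_val_inj/cast_ord_inj.
have [w w_inj] := separating_weights pts_inj.
pose u (K : comNzRingType) : {mpoly K[n + m]} := \sum_i (w i)%:R *: 'X_i.
have bu (K : comNzRingType) : bideg 1 1 (u K).
  apply: bideg_sum => i _; apply/bidegZ/bidegX; have := mdeg1 i; rewrite (@mdeg_split n m); lia.
have map_u (K K' : comNzRingType) (th : {rmorphism K -> K'}) : map_mpoly th (u K) = u K'.
  rewrite rmorph_sum; apply: eq_bigr => i _.
  by rewrite /= map_mpolyZ map_mpolyX rmorph_nat.
have u_inj : injective (fun q => (u C).@[pts q]).
  move=> q1 q2 e; apply: w_inj; move: e; rewrite /u !raddf_sum /=.
  under eq_bigr do rewrite mevalZ mevalXU.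
  by under [X in _ = X -> _]eq_bigr do rewrite mevalZ mevalXU.
(* Room for u ^ D, and for the basis monomials of the model. *)
pose a := (D + 2 * m)%N; pose b := D.
have Da : (D <= a)%N by rewrite leq_addr.
have a0 : (0 < a)%N := leq_trans D0 Da.
have a2m : (2 * m <= a)%N by rewrite leq_addl.
pose f0 := @model_quad R n m.
have f0z q k : (complex_kkt f0 k).@[pts q] = 0 by rewrite model_quadE pts0z.
have f0r : (ncols n m a b <= \rank (macaulay_mx a b (complex_kkt f0)) + D)%N.
  by rewrite model_quadE; apply: (model_rank t_inj t0 tau0 taut char2).
have sC (f : 'I_m.+1 -> quadratic R n) : shape (complex_kkt f) by apply: kkt_shape.
have [sel sel0] := selection_exists (sC f0) (bu C) Da (leqnn D) f0z u_inj f0r.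
pose FT := @univ_kkt R n m.
pose eT := eliminant sel FT (u _).
pose dT := \det (selected sel FT (u _)).
pose p := dT * resultant eT eT^`().
have FTE f : (fun k => map_mpoly (specialize f) (FT k)) = complex_kkt f.
  by apply: funext => k; apply: map_univ_kkt.
have specD f : specialize f dT = \det (selected sel (complex_kkt f) (u C)).
  by rewrite /dT -det_map_mx map_selected map_u FTE.
have specE f : map_poly (specialize f) eT = eliminant sel (complex_kkt f) (u C).
  by rewrite /eT map_eliminant map_u FTE.
have natD0 : D%:R != 0 :> C by rewrite pnatr_eq0 -lt0n.
have specR f : \det (selected sel (complex_kkt f) (u C)) != 0 ->
  specialize f (resultant eT eT^`()) =
    resultant (eliminant sel (complex_kkt f) (u C)) (eliminant sel (complex_kkt f) (u C))^`().
  move=> d0; have dT0 : dT != 0.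
    by apply: contraNneq d0 => e; rewrite -specD e rmorph0.
  have DdT0 : D%:R * dT != 0.
    apply: contraTneq isT => e; have := congr1 (specialize f) e.
    rewrite rmorphM rmorph_nat rmorph0 /= specD => /eqP.
    by rewrite mulf_eq0 (negbTE natD0) (negbTE d0).
  rewrite map_resultant_eq_size.
  - by rewrite -deriv_map specE.
  - by rewrite specE !size_eliminant.
  - by rewrite -deriv_map specE !size_eliminant_deriv // mulf_neq0.
have specp f : (p.@[tuple_coefs f 0] != 0) = (specialize f p != 0).
  by rewrite /specialize /= fmorph_eq0.
exists [set f | p.@[tuple_coefs f 0] != 0]; split.
- exists [set p]; apply/seteqP; split=> f /=; first by exists p.
  by case=> _ ->.
- exists f0; rewrite /= specp /p rmorphM mulf_neq0 //= ?specD // specR //.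
  exact: (eliminant_separable (sC f0) (bu C) Da (leqnn D) sel0 f0z u_inj).
move=> f /=; rewrite specp /p rmorphM /= mulf_eq0 negb_or specD => /andP[d0].
rewrite specR // => r0.
have rk a' b' : (a <= a')%N -> (b <= b')%N ->
    (\rank (macaulay_mx a' b' (complex_kkt f)) + D <= ncols n m a' b')%N.
  move=> ha hb; apply: kkt_system_rank => //; first exact: leq_trans hb.
  exact: leq_trans ha.
have [s [us ss sP]] := zeros_count (sC f) (bu C) Da (leqnn D) a0 D0 rk d0 r0.
by rewrite -ss; apply: degree_of_zeros.
Qed.
End Main.

Theorem mainTheorem4 (R : realType) (n m : nat) (hmn : (m <= n)%N) :
  (forall (l : nat) (hml : (m <= l)%N) (f : 'I_l.+1 -> quadratic R n)
      (x : 'cV[R]_n),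
    optimal f x ->
    (forall i : 'I_l, active f x i <-> (i < m)%N) ->
    finite_set (KKT_solutions (first_quads hml f)) ->
    (algebraic_degree (first_quads hml f) <= 2 ^ m * 'C(n, m))%N)
  /\
  (exists U : set ('I_m.+1 -> quadratic R n),
    [/\ Zariski_open U, U !=set0 &
      forall f, U f ->
        finite_set (KKT_solutions f) /\
        algebraic_degree f = (2 ^ m * 'C(n, m))%N]).
Proof.
split; last exact: generic_degree.
by move=> l hml f x _ _; apply: degree_upper.
Qed.
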